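(* Let $a>0$ and $\epsilon\in[0,\tfrac12]$ be fixed, and consider the binary censored block model with $p=a\log n/n$. Let $\widehat Y_{\mathrm{SDP}}$ be the solution of $$\max_Y\ \langle A,Y\rangle\quad\text{s.t.}\quad Y\succeq0,\ \ Y_{ii}=1\ (i\in[n]).$$ If $a(\sqrt{1-\epsilon}-\sqrt\epsilon)^2>1$, then $\min_{Y^*\in\mathcal Y_n}\mathbb P\{\widehat Y_{\mathrm{SDP}}=Y^*\}\ge1-n^{-\Omega(1)}$ as $n\to\infty$ (where $\widehat Y_{\mathrm{SDP}}=Y^*$ means $Y^*$ is the unique optimal solution).
   Context: Binary censored block model: $\sigma^*\in\{\pm1\}^n$ is the true labeling. The graph $G$ is Erdős–Rényi $\mathcal G(n,p)$ (independent of $\sigma^*$), and each edge $(i,j)$ independently receives a label $L_{ij}\in\{\pm1\}$ with $L_{ij}=\sigma^*_i\sigma^*_j$ with probability $1-\epsilon$ and $L_{ij}=-\sigma^*_i\sigma^*_j$ with probability $\epsilon$. $A$ is the symmetric weighted adjacency matrix: $A_{ij}=0$ if $\{i,j\}$ is not an edge and $A_{ij}=L_{ij}$ otherwise ($A_{ii}=0$). $Y^*=\sigma^*(\sigma^* )^\top$, $\mathcal Y_n=\{\sigma\sigma^\top:\sigma\in\{\pm1\}^n\}$. *)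

(* Defs.v *)
From Stdlib Require Import Reals List Classical ClassicalEpsilon.
Import ListNotations.
Open Scope R_scope.

Definition rsum (n : nat) (f : nat -> R) : R :=
  fold_right Rplus 0 (map f (seq 0 n)).

(* Outcome of the random experiment, per unordered pair {i,j} with i<j:
   None           = no edge
   Some true      = edge with correct label  L_ij =  sigma_i sigma_j
   Some false     = edge with flipped label  L_ij = -sigma_i sigma_j *)
Definition cfg := nat -> nat -> option bool.

Definition cfg0 : cfg := fun _ _ => None.

Definition cfg_upd (c : cfg) (i j : nat) (v : option bool) : cfg :=
  fun k l => if andb (Nat.eqb k i) (Nat.eqb l j) then v else c k l.

Definition pairs (n : nat) : list (nat * nat) :=
  flat_map (fun j => map (fun i => (i, j)) (seq 0 j)) (seq 0 n).

Fixpoint expect (p eps : R) (ps : list (nat * nat)) (f : cfg -> R) (c : cfg) : R :=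
  match ps with
  | [] => f c
  | (i, j) :: ps' =>
      (1 - p) * expect p eps ps' f (cfg_upd c i j None)
      + p * (1 - eps) * expect p eps ps' f (cfg_upd c i j (Some true))
      + p * eps * expect p eps ps' f (cfg_upd c i j (Some false))
  end.

Definition indic (P : Prop) : R :=
  if excluded_middle_informative P then 1 else 0.

Definition prob (n : nat) (p eps : R) (E : cfg -> Prop) : R :=
  expect p eps (pairs n) (fun c => indic (E c)) cfg0.

Definition adj (sigma : nat -> R) (c : cfg) (i j : nat) : R :=
  let entry k l :=
    match c k l with
    | None => 0
    | Some true => sigma k * sigma l
    | Some false => - (sigma k * sigma l)
    end in
  if Nat.ltb i j then entry i j else if Nat.ltb j i then entry j i else 0.

Definition inner (n : nat) (A Y : nat -> nat -> R) : R :=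
  rsum n (fun i => rsum n (fun j => A i j * Y i j)).

Definition sdp_feasible (n : nat) (Y : nat -> nat -> R) : Prop :=
  (forall i j, (i < n)%nat -> (j < n)%nat -> Y i j = Y j i) /\
  (forall x : nat -> R, 0 <= rsum n (fun i => rsum n (fun j => x i * Y i j * x j))) /\
  (forall i, (i < n)%nat -> Y i i = 1).

Definition sdp_unique_opt (n : nat) (A Ystar : nat -> nat -> R) : Prop :=
  sdp_feasible n Ystar /\
  (forall Y, sdp_feasible n Y -> inner n A Ystar <= inner n A Y ->
     forall i j, (i < n)%nat -> (j < n)%nat -> Y i j = Ystar i j).

Definition sign_vec (n : nat) (sigma : nat -> R) : Prop :=
  forall i, (i < n)%nat -> sigma i = 1 \/ sigma i = -1.

(* Main.v *)
(* Conjugating by [sigma], the observation becomes a symmetric matrix [B] with entries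
   [0, 1, -1] whose mean is [mu (J - I)], [mu = p (1 - 2 eps)], and the claim is that [J] is
   the unique optimum. By duality it suffices that every row sum of [B] exceeds
   [sup_x x^T (B - mu J) x / |x|^2]. With [L = ln n], Chernoff's bound and the hypothesis
   [a (sqrt (1 - eps) - sqrt eps)^2 > 1] bound the row sums below by a small constant times
   [L], so it is enough to show that the quadratic form is at most [eta L |x|^2] for every
   fixed [eta > 0]. This follows Kahn and Szemeredi: [x] is rounded to a lattice of mesh of
   order [1 / sqrt n] (the error is controlled by row sums); for the pairs with
   [|x_i x_j| <= tau], [tau] of order [L / n], a Bernstein bound beats the [exp (O (n))]
   lattice points; the other pairs are controlled by the maximal degree and by the fact that
   every set of [O (n / L)] vertices spans few edges per vertex. Each bad event is encoded by a
   sum of exponentials which is at least [1] when the event occurs. *)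

Require Import Defs.
From Stdlib Require Import Reals Lra Lia Psatz List Arith Classical ClassicalEpsilon.
Import ListNotations.
Open Scope R_scope.

(** * Finite sums *)

(** Only the lower tail of the row sums has to be sharp, since the condition on [a] enters through
    it alone; the other estimates may waste constants. The obstacle is the size of the lattice: to
    beat [exp (O (n))] points with a deviation [d L], the exponential tilt [s] must be of order
    [n / L], and the quadratic bound on the moment is available only while [s |x_i x_j|] stays
    bounded. This fixes [tau] at order [1 / s]. Heavy pairs are therefore bounded deterministically,
    by properties of the graph that hold for all [x] at once. The lower bound [8 d L] on the row
    sums pays for six losses of at most [d L] each: light pairs, unbalanced heavy pairs, the two
    halves of an AM-GM bound inside the small set, the mean on heavy pairs, and the rounding. *)

Definition lsum {A : Type} (l : list A) (f : A -> R) : R :=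
  fold_right Rplus 0 (map f l).

Lemma lsum_cons {A} (x : A) l f : lsum (x :: l) f = f x + lsum l f.
Proof. reflexivity. Qed.

Lemma lsum_app {A} (l1 l2 : list A) f : lsum (l1 ++ l2) f = lsum l1 f + lsum l2 f.
Proof.
  induction l1 as [|x l1 IH]; simpl; [unfold lsum; simpl; lra|].
  rewrite !lsum_cons, IH; lra.
Qed.

Lemma lsum_ext {A} (l : list A) f g :
  (forall x, In x l -> f x = g x) -> lsum l f = lsum l g.
Proof.
  induction l as [|x l IH]; intros H; [reflexivity|].
  rewrite !lsum_cons, IH, H; [reflexivity | now left | intros; apply H; now right].
Qed.

Lemma lsum_le {A} (l : list A) f g :
  (forall x, In x l -> f x <= g x) -> lsum l f <= lsum l g.
Proof.
  induction l as [|x l IH]; intros H; [unfold lsum; simpl; lra|].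
  rewrite !lsum_cons.
  apply Rplus_le_compat; [apply H; now left | apply IH; intros; apply H; now right].
Qed.

Lemma lsum_plus {A} (l : list A) f g : lsum l (fun x => f x + g x) = lsum l f + lsum l g.
Proof.
  induction l as [|x l IH]; [unfold lsum; simpl; lra|].
  rewrite !lsum_cons, IH; lra.
Qed.

Lemma lsum_scal {A} (l : list A) k f : lsum l (fun x => k * f x) = k * lsum l f.
Proof.
  induction l as [|x l IH]; [unfold lsum; simpl; lra|].
  rewrite !lsum_cons, IH; lra.
Qed.

Lemma lsum_zero {A} (l : list A) : lsum l (fun _ => 0) = 0.
Proof. induction l as [|x l IH]; [reflexivity|]. rewrite lsum_cons, IH; lra. Qed.

Lemma lsum_nonneg {A} (l : list A) f : (forall x, In x l -> 0 <= f x) -> 0 <= lsum l f.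
Proof. intros H. rewrite <- (lsum_zero l). now apply lsum_le. Qed.

Lemma lsum_ge_term {A} (l : list A) f x :
  (forall y, In y l -> 0 <= f y) -> In x l -> f x <= lsum l f.
Proof.
  induction l as [|y l IH]; intros H Hx; [easy|].
  rewrite lsum_cons. destruct Hx as [->|Hx].
  - enough (0 <= lsum l f) by lra.
    apply lsum_nonneg; intros; apply H; now right.
  - specialize (IH (fun z Hz => H z (or_intror Hz)) Hx).
    specialize (H y (or_introl eq_refl)); lra.
Qed.

Lemma lsum_swap {A B} (l : list A) (m : list B) f :
  lsum l (fun x => lsum m (fun y => f x y)) = lsum m (fun y => lsum l (fun x => f x y)).
Proof.
  induction l as [|x l IH].
  - unfold lsum at 1; simpl. symmetry; apply lsum_zero.
  - rewrite lsum_cons, IH, <- lsum_plus. reflexivity.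
Qed.

Lemma lsum_map {A B} (h : A -> B) l f : lsum (map h l) f = lsum l (fun x => f (h x)).
Proof. unfold lsum; now rewrite map_map. Qed.

Lemma lsum_flat_map {A B} (h : A -> list B) l f :
  lsum (flat_map h l) f = lsum l (fun x => lsum (h x) f).
Proof.
  induction l as [|x l IH]; [reflexivity|].
  simpl; rewrite lsum_app, lsum_cons, IH; reflexivity.
Qed.

Lemma rsum_S n f : rsum (S n) f = rsum n f + f n.
Proof.
  change (lsum (seq 0 (S n)) f = lsum (seq 0 n) f + f n).
  rewrite seq_S, lsum_app; unfold lsum at 2; simpl; lra.
Qed.

Lemma rsum_ext n f g : (forall i, (i < n)%nat -> f i = g i) -> rsum n f = rsum n g.
Proof. intros H; apply lsum_ext; intros i Hi; apply in_seq in Hi; apply H; lia. Qed.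

Lemma rsum_le n f g : (forall i, (i < n)%nat -> f i <= g i) -> rsum n f <= rsum n g.
Proof. intros H; apply lsum_le; intros i Hi; apply in_seq in Hi; apply H; lia. Qed.

Lemma rsum_plus n f g : rsum n (fun x => f x + g x) = rsum n f + rsum n g.
Proof. apply lsum_plus. Qed.

Lemma rsum_scal n k f : rsum n (fun x => k * f x) = k * rsum n f.
Proof. apply lsum_scal. Qed.

Lemma rsum_zero n : rsum n (fun _ => 0) = 0.
Proof. apply lsum_zero. Qed.

Lemma rsum_const n k : rsum n (fun _ => k) = INR n * k.
Proof.
  induction n as [|n IH]; [unfold rsum; simpl; lra|].
  rewrite rsum_S, IH, S_INR; lra.
Qed.

Lemma rsum_nonneg n f : (forall i, (i < n)%nat -> 0 <= f i) -> 0 <= rsum n f.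
Proof. intros H; rewrite <- (rsum_zero n); now apply rsum_le. Qed.

Lemma rsum_ge_term n f i :
  (forall j, (j < n)%nat -> 0 <= f j) -> (i < n)%nat -> f i <= rsum n f.
Proof.
  intros H Hi. apply (lsum_ge_term (seq 0 n)).
  - intros j Hj; apply in_seq in Hj; apply H; lia.
  - apply in_seq; lia.
Qed.

Lemma rsum_delta n i f :
  (i < n)%nat -> rsum n (fun j => if Nat.eqb j i then f j else 0) = f i.
Proof.
  induction n as [|n IH]; intros Hi; [lia|].
  rewrite rsum_S. destruct (Nat.eqb_spec n i) as [->|Hn].
  - rewrite (rsum_ext i _ (fun _ => 0)), rsum_zero; [lra|].
    intros j Hj. destruct (Nat.eqb_spec j i); [lia|reflexivity].
  - rewrite IH by lia; lra.
Qed.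

Definition dsum (n : nat) (F : nat -> nat -> R) : R :=
  rsum n (fun i => rsum n (fun j => F i j)).

Lemma dsum_ext n F G :
  (forall i j, (i < n)%nat -> (j < n)%nat -> F i j = G i j) -> dsum n F = dsum n G.
Proof. intros H; apply rsum_ext; intros; apply rsum_ext; auto. Qed.

Lemma dsum_le n F G :
  (forall i j, (i < n)%nat -> (j < n)%nat -> F i j <= G i j) -> dsum n F <= dsum n G.
Proof. intros H; apply rsum_le; intros; apply rsum_le; auto. Qed.

Lemma dsum_plus n F G : dsum n (fun i j => F i j + G i j) = dsum n F + dsum n G.
Proof. unfold dsum. rewrite <- rsum_plus. apply rsum_ext; intros; apply rsum_plus. Qed.

Lemma dsum_scal n k F : dsum n (fun i j => k * F i j) = k * dsum n F.
Proof. unfold dsum. rewrite <- rsum_scal. apply rsum_ext; intros; apply rsum_scal. Qed.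

Lemma dsum_swap n F : dsum n F = dsum n (fun i j => F j i).
Proof. apply lsum_swap. Qed.

Lemma dsum_prod n f g : dsum n (fun i j => f i * g j) = rsum n f * rsum n g.
Proof.
  unfold dsum. rewrite Rmult_comm, <- rsum_scal.
  apply rsum_ext; intros; rewrite rsum_scal; ring.
Qed.

Lemma dsum_row n F f : dsum n (fun i j => f i * F i j) = rsum n (fun i => f i * rsum n (F i)).
Proof. apply rsum_ext; intros; apply rsum_scal. Qed.

Lemma dsum_S n F :
  dsum (S n) F = dsum n F + rsum n (fun i => F i n) + rsum n (fun j => F n j) + F n n.
Proof.
  unfold dsum. rewrite rsum_S.
  rewrite (rsum_ext n _ (fun i => rsum n (fun j => F i j) + F i n)).
  - rewrite rsum_plus, rsum_S; lra.
  - intros; apply rsum_S.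
Qed.

Definition psum (n : nat) (F : nat -> nat -> R) : R :=
  lsum (pairs n) (fun q => F (fst q) (snd q)).

Lemma pairs_S n : pairs (S n) = pairs n ++ map (fun i => (i, n)) (seq 0 n).
Proof. unfold pairs. rewrite seq_S, flat_map_app. simpl. now rewrite app_nil_r. Qed.

Lemma in_pairs n i j : In (i, j) (pairs n) -> (i < j < n)%nat.
Proof.
  unfold pairs. intros H. apply in_flat_map in H as (k & Hk & H).
  apply in_map_iff in H as (l & He & Hl). injection He as <- <-.
  apply in_seq in Hk, Hl; lia.
Qed.

Lemma NoDup_pairs n : NoDup (pairs n).
Proof.
  induction n as [|n IH]; [constructor|].
  rewrite pairs_S. apply NoDup_app; [exact IH| |].
  - apply NoDup_map_NoDup_ForallPairs; [|apply seq_NoDup].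
    intros x y _ _ H; congruence.
  - intros [i j] H1 H2. apply in_pairs in H1.
    apply in_map_iff in H2 as (l & He & _). injection He as <- <-; lia.
Qed.

Lemma psum_S n F : psum (S n) F = psum n F + rsum n (fun i => F i n).
Proof. unfold psum. rewrite pairs_S, lsum_app, lsum_map. reflexivity. Qed.

Lemma psum_ext n F G :
  (forall i j, (i < j)%nat -> (j < n)%nat -> F i j = G i j) -> psum n F = psum n G.
Proof. intros H; apply lsum_ext; intros [i j] Hq; apply in_pairs in Hq; apply H; simpl; lia. Qed.

Lemma psum_le n F G :
  (forall i j, (i < j)%nat -> (j < n)%nat -> F i j <= G i j) -> psum n F <= psum n G.
Proof. intros H; apply lsum_le; intros [i j] Hq; apply in_pairs in Hq; apply H; simpl; lia. Qed.

Lemma psum_plus n F G : psum n (fun i j => F i j + G i j) = psum n F + psum n G.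
Proof. apply lsum_plus. Qed.

Lemma psum_scal n k F : psum n (fun i j => k * F i j) = k * psum n F.
Proof. apply lsum_scal. Qed.

Lemma dsum_psum n F :
  dsum n F = psum n (fun i j => F i j + F j i) + rsum n (fun i => F i i).
Proof.
  induction n as [|n IH]; [unfold dsum, psum, pairs, rsum, lsum; simpl; lra|].
  rewrite dsum_S, psum_S, rsum_S, IH, (rsum_plus n (fun i => F i n) (fun j => F n j)); lra.
Qed.

(** * Expectation over independent edge outcomes *)

Section Expect.
Context (p eps : R) (hp : 0 <= p <= 1) (he : 0 <= eps <= 1).

(** Only configurations agreeing with [c] off [ps] are compared, since [expect] never alters those
    entries. A value already drawn can thus be treated as a constant while the remaining pairs are
    averaged. *)
Lemma expect_le ps f g c :
  (forall c', (forall k l, ~ In (k, l) ps -> c' k l = c k l) -> f c' <= g c') ->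
  expect p eps ps f c <= expect p eps ps g c.
Proof.
  revert c; induction ps as [|[i j] ps IH]; intros c H; simpl; [now apply H|].
  assert (E : forall v, expect p eps ps f (cfg_upd c i j v) <=
                        expect p eps ps g (cfg_upd c i j v)).
  { intros v; apply IH; intros c' Hc'; apply H; intros k l Hkl.
    rewrite Hc' by (intros K; apply Hkl; now right).
    unfold cfg_upd. destruct (Nat.eqb_spec k i), (Nat.eqb_spec l j); simpl; try reflexivity.
    subst; exfalso; apply Hkl; now left. }
  assert (0 <= p * (1 - eps)) by (apply Rmult_le_pos; lra).
  assert (0 <= p * eps) by (apply Rmult_le_pos; lra).
  repeat apply Rplus_le_compat; apply Rmult_le_compat_l; auto; lra.
Qed.

Lemma expect_ext ps f g c :
  (forall c', (forall k l, ~ In (k, l) ps -> c' k l = c k l) -> f c' = g c') ->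
  expect p eps ps f c = expect p eps ps g c.
Proof.
  intros H; apply Rle_antisym; apply expect_le; intros c' Hc'; rewrite (H c' Hc'); lra.
Qed.

Lemma expect_scal ps k f c :
  expect p eps ps (fun c => k * f c) c = k * expect p eps ps f c.
Proof.
  revert c; induction ps as [|[i j] ps IH]; intros c; simpl; [reflexivity|].
  rewrite !IH; ring.
Qed.

Lemma expect_plus ps f g c :
  expect p eps ps (fun c => f c + g c) c = expect p eps ps f c + expect p eps ps g c.
Proof.
  revert c; induction ps as [|[i j] ps IH]; intros c; simpl; [reflexivity|].
  rewrite !IH; ring.
Qed.

Lemma expect_const ps k c : expect p eps ps (fun _ => k) c = k.
Proof.
  revert c; induction ps as [|[i j] ps IH]; intros c; simpl; [reflexivity|].
  rewrite !IH; ring.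
Qed.

Lemma expect_lsum {A} (l : list A) ps f c :
  expect p eps ps (fun c => lsum l (fun x => f x c)) c =
  lsum l (fun x => expect p eps ps (f x) c).
Proof.
  induction l as [|x l IH].
  - apply (expect_const ps 0).
  - rewrite lsum_cons, <- IH, <- expect_plus. reflexivity.
Qed.

(** Independence in Chernoff form: the moment factorizes over the pairs, and [1 + u <= exp u]
    replaces each factor. [NoDup] keeps a drawn value from being overwritten later in the recursion;
    [g q None = 0] makes an absent edge contribute the factor 1. *)
Lemma expect_exp_le ps (g : nat * nat -> option bool -> R) c :
  NoDup ps -> (forall q, g q None = 0) ->
  expect p eps ps (fun c => exp (lsum ps (fun q => g q (c (fst q) (snd q))))) c <=
  exp (lsum ps (fun q => p * ((1 - eps) * (exp (g q (Some true)) - 1)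
                              + eps * (exp (g q (Some false)) - 1)))).
Proof.
  intros Hnd Hg. revert c; induction Hnd as [|[i j] ps Hni Hnd IH]; intros c.
  { unfold lsum; simpl; lra. }
  rewrite lsum_cons, exp_plus.
  set (T := exp (lsum ps _)) in *.
  assert (E : forall v,
    expect p eps ps (fun c => exp (lsum ((i, j) :: ps) (fun q => g q (c (fst q) (snd q)))))
       (cfg_upd c i j v) <= exp (g (i, j) v) * T).
  { intros v. rewrite (expect_ext _ _
      (fun c => exp (g (i, j) v) * exp (lsum ps (fun q => g q (c (fst q) (snd q)))))).
    - rewrite expect_scal. apply Rmult_le_compat_l; [left; apply exp_pos|apply IH].
    - intros c' Hc'. rewrite lsum_cons, exp_plus. simpl. rewrite Hc' by exact Hni.
      unfold cfg_upd; now rewrite !Nat.eqb_refl. }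
  simpl.
  assert (HT : 0 < T) by apply exp_pos.
  pose proof (E None) as E0. rewrite Hg, exp_0 in E0.
  assert (0 <= p * (1 - eps)) by (apply Rmult_le_pos; lra).
  assert (0 <= p * eps) by (apply Rmult_le_pos; lra).
  apply Rle_trans with
    ((1 - p) * (1 * T) + p * (1 - eps) * (exp (g (i, j) (Some true)) * T)
     + p * eps * (exp (g (i, j) (Some false)) * T)).
  { repeat apply Rplus_le_compat; apply Rmult_le_compat_l; auto; lra. }
  match goal with |- _ <= exp ?x * T => set (u := x) end.
  apply Rle_trans with ((1 + u) * T); [unfold u; simpl; lra|].
  apply Rmult_le_compat_r; [lra|]. apply exp_ineq1_le.
Qed.

End Expect.

(** * Positive semidefinite certificates *)

Definition quad (n : nat) (M : nat -> nat -> R) (x : nat -> R) : R :=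
  dsum n (fun i j => x i * M i j * x j).

Lemma quad_diag n M i t s k :
  (i < n)%nat -> (k < n)%nat -> i <> k -> M i k = M k i ->
  quad n M (fun j => if Nat.eqb j i then t else if Nat.eqb j k then s else 0) =
  t * t * M i i + 2 * t * s * M i k + s * s * M k k.
Proof.
  intros Hi Hk Hik Hs. unfold quad, dsum.
  set (x := fun j => if Nat.eqb j i then t else if Nat.eqb j k then s else 0).
  assert (E : forall G, rsum n (fun j => G j * x j) = G i * t + G k * s).
  { intros G.
    rewrite (rsum_ext n _ (fun j => (if Nat.eqb j i then G j * t else 0)
                                    + (if Nat.eqb j k then G j * s else 0))).
    - rewrite rsum_plus, (rsum_delta n i (fun j => G j * t)),
        (rsum_delta n k (fun j => G j * s)); auto.
    - intros j _. unfold x; cbv beta.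
      destruct (Nat.eqb_spec j i), (Nat.eqb_spec j k); [congruence|ring..]. }
  rewrite (rsum_ext n _ (fun a => (M a i * t + M a k * s) * x a)).
  - rewrite E, Hs; ring.
  - intros a _. change (rsum n (fun j => x a * M a j * x j) = (M a i * t + M a k * s) * x a).
    rewrite (E (fun b => x a * M a b)); ring.
Qed.

(* If a positive semidefinite matrix has a zero diagonal entry, the whole row vanishes:
   otherwise a large multiple of the corresponding coordinate makes the form negative. *)
Lemma psd_zero_row n Z i k :
  (forall a b, (a < n)%nat -> (b < n)%nat -> Z a b = Z b a) ->
  (forall x, 0 <= quad n Z x) ->
  (i < n)%nat -> (k < n)%nat -> Z k k = 0 -> Z i k = 0.
Proof.
  intros Hs Hp Hi Hk H0. destruct (Nat.eq_dec i k) as [->|Hik]; [exact H0|].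
  destruct (Req_dec (Z i k) 0) as [|Hne]; [assumption|exfalso].
  pose proof (Hp (fun j => if Nat.eqb j i then 1
     else if Nat.eqb j k then - (Z i i + 1) / (2 * Z i k) else 0)) as H.
  rewrite (quad_diag n Z i 1 _ k) in H by auto. rewrite H0 in H.
  replace (2 * 1 * (- (Z i i + 1) / (2 * Z i k)) * Z i k) with (- (Z i i + 1)) in H
    by (field; auto).
  lra.
Qed.

Lemma psd_diag_nonneg n Z k : (forall x, 0 <= quad n Z x) -> (k < n)%nat -> 0 <= Z k k.
Proof.
  intros Hp Hk.
  pose proof (Hp (fun j => if Nat.eqb j k then 1 else 0)) as H.
  unfold quad, dsum in H.
  rewrite (rsum_ext n _ (fun a => if Nat.eqb a k then Z a k else 0)) in H.
  - now rewrite (rsum_delta n k (fun a => Z a k)) in H.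
  - intros a _. destruct (Nat.eqb a k).
    + rewrite (rsum_ext n _ (fun j => if Nat.eqb j k then Z a j else 0)).
      * now rewrite (rsum_delta n k (fun j => Z a j)).
      * intros j _; destruct (Nat.eqb j k); ring.
    + rewrite (rsum_ext n _ (fun _ => 0)); [apply rsum_zero|intros; ring].
Qed.

(** The test vector [e_i - e_k] gives the form the value [2 - 2 * Z i k]. *)
Lemma psd_entry_le n Z i k :
  (forall a b, (a < n)%nat -> (b < n)%nat -> Z a b = Z b a) ->
  (forall x, 0 <= quad n Z x) ->
  (i < n)%nat -> (k < n)%nat -> Z i i = 1 -> Z k k = 1 -> Z i k <= 1.
Proof.
  intros Hs Hp Hi Hk H1 H2. destruct (Nat.eq_dec i k) as [->|Hik]; [lra|].
  pose proof (Hp (fun j => if Nat.eqb j i then 1 else if Nat.eqb j k then -1 else 0)) as H.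
  rewrite (quad_diag n Z i 1 _ k) in H by auto. rewrite H1, H2 in H; lra.
Qed.

(* Induction on the size: eliminating the last coordinate of [Z] (Schur complement)
   splits off a rank-one term, on which the pairing is a value of the form [M]. *)
Lemma psd_pairing_nonneg n : forall M Z,
  (forall x, 0 <= quad n M x) ->
  (forall i j, (i < n)%nat -> (j < n)%nat -> Z i j = Z j i) ->
  (forall x, 0 <= quad n Z x) ->
  0 <= dsum n (fun i j => M i j * Z i j).
Proof.
  induction n as [|n IH]; intros M Z HM Hs HZ; [unfold dsum, rsum; simpl; lra|].
  assert (HM' : forall x, 0 <= quad n M x).
  { intros x. specialize (HM (fun j => if Nat.eqb j n then 0 else x j)).
    unfold quad in *. rewrite dsum_S in HM. rewrite Nat.eqb_refl in HM.
    rewrite (rsum_ext n (fun i => _ * M i n * 0) (fun _ => 0)) in HM by (intros; ring).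
    rewrite (rsum_ext n (fun i => 0 * M n i * _) (fun _ => 0)) in HM by (intros; ring).
    rewrite rsum_zero in HM.
    rewrite (dsum_ext n _ (fun i j => x i * M i j * x j)) in HM; [lra|].
    intros i j Hi Hj. destruct (Nat.eqb_spec i n), (Nat.eqb_spec j n); [lia..|reflexivity]. }
  destruct (Req_dec (Z n n) 0) as [H0|H0].
  - assert (Hr : forall i, (i < n)%nat -> Z i n = 0)
      by (intros; apply (psd_zero_row (S n)); auto; lia).
    rewrite dsum_S.
    rewrite (rsum_ext n (fun i => M i n * Z i n) (fun _ => 0))
      by (intros i Hi; rewrite (Hr i Hi); ring).
    rewrite (rsum_ext n (fun i => M n i * Z n i) (fun _ => 0))
      by (intros i Hi; rewrite (Hs n i), (Hr i Hi) by lia; ring).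
    rewrite rsum_zero, H0.
    enough (0 <= dsum n (fun i j => M i j * Z i j)) by lra.
    apply IH; auto. intros x.
    specialize (HZ (fun j => if Nat.eqb j n then 0 else x j)).
    unfold quad in *. rewrite dsum_S in HZ. rewrite Nat.eqb_refl in HZ.
    rewrite (rsum_ext n (fun i => _ * Z i n * 0) (fun _ => 0)) in HZ by (intros; ring).
    rewrite (rsum_ext n (fun i => 0 * Z n i * _) (fun _ => 0)) in HZ by (intros; ring).
    rewrite rsum_zero in HZ.
    rewrite (dsum_ext n _ (fun i j => x i * Z i j * x j)) in HZ; [lra|].
    intros i j Hi Hj. destruct (Nat.eqb_spec i n), (Nat.eqb_spec j n); [lia..|reflexivity].
  - assert (Hpos : 0 < Z n n).
    { assert (0 <= Z n n) by (apply (psd_diag_nonneg (S n)); auto). lra. }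
    set (z := fun i => Z i n). set (d := Z n n) in *.
    set (Z' := fun i j => Z i j - z i * z j / d).
    assert (E1 : dsum (S n) (fun i j => M i j * Z i j) =
                 dsum n (fun i j => M i j * Z' i j) + / d * quad (S n) M z).
    (* The last row and column of [Z'] vanish, so the sum of size [S n] collapses to size [n]. *)
    { assert (E0 : dsum (S n) (fun i j => M i j * Z' i j) = dsum n (fun i j => M i j * Z' i j)).
      { rewrite dsum_S.
        rewrite (rsum_ext n (fun i => M i n * Z' i n) (fun _ => 0))
          by (intros i Hi; unfold Z', z; fold d; field; lra).
        rewrite (rsum_ext n (fun i => M n i * Z' n i) (fun _ => 0))
          by (intros i Hi; unfold Z', z; fold d; rewrite (Hs n i) by lia; field; lra).
        rewrite rsum_zero. unfold Z', z; fold d. field; lra. }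
      rewrite <- E0. unfold quad.
      rewrite <- dsum_scal, <- dsum_plus. apply dsum_ext; intros i j Hi Hj.
      unfold Z'. field; lra. }
    rewrite E1.
    assert (0 < / d) by now apply Rinv_0_lt_compat.
    apply Rplus_le_le_0_compat; [|apply Rmult_le_pos; auto; lra].
    apply IH; auto.
    + intros i j Hi Hj. unfold Z'. rewrite (Hs i j) by lia. field; lra.
    + intros x.
      (* The last coordinate [- (w / d)] minimizes the form of [Z] when the others are fixed, and
         the minimum is the form of [Z'] at [x]. *)
      set (w := rsum n (fun i => x i * z i)).
      specialize (HZ (fun j => if Nat.eqb j n then - (w / d) else x j)).
      unfold quad in *. rewrite dsum_S in HZ. rewrite Nat.eqb_refl in HZ. fold d in HZ.
      rewrite (rsum_ext n (fun i => _ * Z i n * _) (fun i => - (w / d) * (x i * z i))) in HZ.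
      2:{ intros i Hi. destruct (Nat.eqb_spec i n); [lia|]. unfold z; ring. }
      rewrite (rsum_ext n (fun i => _ * Z n i * _) (fun i => - (w / d) * (x i * z i))) in HZ.
      2:{ intros i Hi. destruct (Nat.eqb_spec i n); [lia|]. unfold z.
          rewrite (Hs n i) by lia; ring. }
      rewrite rsum_scal in HZ. fold w in HZ.
      rewrite (dsum_ext n _ (fun i j => x i * Z' i j * x j
                 + / d * ((x i * z i) * (x j * z j)))) in HZ.
      2:{ intros i j Hi Hj. destruct (Nat.eqb_spec i n), (Nat.eqb_spec j n); [lia..|].
          unfold Z'; field; lra. }
      rewrite dsum_plus, dsum_scal, (dsum_prod n (fun i => x i * z i) (fun i => x i * z i)) in HZ.
      fold w in HZ.
      replace (- (w / d) * d * - (w / d)) with (/ d * (w * w)) in HZ by (field; lra).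
      replace (- (w / d) * w) with (- (/ d * (w * w))) in HZ by (field; lra).
      lra.
Qed.

Lemma dsum_diag n f :
  dsum n (fun i j => if Nat.eqb j i then f i j else 0) = rsum n (fun i => f i i).
Proof. apply rsum_ext; intros i Hi; now rewrite (rsum_delta n i (f i)). Qed.

(** The constant vector lies in the kernel of the symmetric matrix [M], so every term containing [m]
    vanishes. *)
Lemma quad_shift n M u m :
  (forall i j, (i < n)%nat -> (j < n)%nat -> M i j = M j i) ->
  (forall i, (i < n)%nat -> rsum n (M i) = 0) ->
  quad n M (fun i => u i + m) = quad n M u.
Proof.
  intros Hs H0.
  assert (Z : forall h, dsum n (fun i j => h i * M i j) = 0).
  { intros h. rewrite dsum_row, (rsum_ext n _ (fun _ => 0)); [apply rsum_zero|].
    intros i Hi; rewrite H0 by auto; ring. }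
  unfold quad.
  rewrite (dsum_ext n _ (fun i j => u i * M i j * u j
             + (m * (u i * M i j) + m * (u j * M i j)) + (m * m) * M i j)) by (intros; ring).
  rewrite !dsum_plus, !dsum_scal, Z.
  rewrite (dsum_swap n (fun i j => u j * M i j)).
  rewrite (dsum_ext n (fun i j => u i * M j i) (fun i j => u i * M i j))
    by (intros; rewrite Hs; auto).
  assert (Z1 : dsum n M = 0)
    by (rewrite <- (Z (fun _ => 1)); apply dsum_ext; intros; ring).
  change (fun i j => M i j) with M. rewrite Z, Z1. ring.
Qed.

(* The certificate is [diag d - B - c (I - J / n)] with [c = dmin - g]: it kills the constant
   vector, and on its orthogonal complement the rank-one part [mu J] does not contribute. *)
Lemma unique_opt_of_certificate n (A B : nat -> nat -> R) sigma mu dmin g :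
  sign_vec n sigma ->
  (forall i j, (i < n)%nat -> (j < n)%nat -> A i j = sigma i * sigma j * B i j) ->
  (forall i j, (i < n)%nat -> (j < n)%nat -> B i j = B j i) ->
  (forall i, (i < n)%nat -> dmin <= rsum n (B i)) ->
  (forall x, quad n (fun i j => B i j - mu) x <= g * rsum n (fun i => x i * x i)) ->
  g < dmin ->
  sdp_unique_opt n A (fun i j => sigma i * sigma j).
Proof.
  intros Hsg HA Bs Hd Hq Hg.
  assert (Hsq : forall i, (i < n)%nat -> sigma i * sigma i = 1).
  { intros i Hi; destruct (Hsg i Hi) as [-> | ->]; ring. }
  split.
  { split; [intros; ring|split; [|exact Hsq]].
    intros x. change (0 <= dsum n (fun i j => x i * (sigma i * sigma j) * x j)).
    rewrite (dsum_ext n _ (fun i j => (x i * sigma i) * (x j * sigma j))) by (intros; ring).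
    rewrite (dsum_prod n (fun i => x i * sigma i) (fun i => x i * sigma i)). apply Rle_0_sqr. }
  intros Y (Ys & Yp & Yd) Hin.
  destruct (Nat.eq_dec n 0) as [->|Hn]; [intros; lia|].
  assert (HN : 0 < INR n) by (apply lt_0_INR; lia).
  set (c := dmin - g). assert (Hc : 0 < c) by (unfold c; lra).
  set (d := fun i => rsum n (B i)).
  set (M := fun i j => (if Nat.eqb j i then d i - c else 0) + (-1 * B i j + c / INR n)).
  set (Z := fun i j => sigma i * Y i j * sigma j).
  assert (Zs : forall i j, (i < n)%nat -> (j < n)%nat -> Z i j = Z j i).
  { intros i j Hi Hj; unfold Z; rewrite (Ys i j) by auto; ring. }
  assert (Zp : forall x, 0 <= quad n Z x).
  { intros x. specialize (Yp (fun i => x i * sigma i)). unfold quad.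
    erewrite dsum_ext; [exact Yp|]. intros; unfold Z; cbv beta; ring. }
  assert (Zd : forall i, (i < n)%nat -> Z i i = 1).
  { intros i Hi; unfold Z. rewrite Yd, Rmult_1_r by auto. auto. }
  assert (Ms : forall i j, (i < n)%nat -> (j < n)%nat -> M i j = M j i).
  { intros i j Hi Hj; unfold M. rewrite (Bs i j), (Nat.eqb_sym j i) by auto.
    destruct (Nat.eqb_spec i j) as [->|]; reflexivity. }
  assert (M0 : forall i, (i < n)%nat -> rsum n (M i) = 0).
  { intros i Hi. unfold M. rewrite rsum_plus, rsum_plus, rsum_const.
    rewrite (rsum_delta n i (fun _ => d i - c)), rsum_scal by auto.
    change (fun j => B i j) with (B i). change (rsum n (B i)) with (d i). field; lra. }
  assert (Mp : forall x, 0 <= quad n M x).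
  (* Once the mean is subtracted, both all-ones parts drop out. What remains is [d i - c >= g],
     which absorbs the form of [B - mu]. *)
  { intros x. set (m := rsum n x / INR n). set (u := fun i => x i - m).
    assert (Hu : rsum n u = 0).
    { unfold u. rewrite (rsum_ext n _ (fun i => x i + -m)) by (intros; ring).
      rewrite rsum_plus, rsum_const. change (rsum n (fun i => x i)) with (rsum n x).
      unfold m; field; lra. }
    replace (quad n M x) with (quad n M (fun i => u i + m))
      by (apply dsum_ext; intros; unfold u; ring).
    rewrite quad_shift by auto.
    specialize (Hq u). unfold quad in *.
    rewrite (dsum_ext n _ (fun i j => (if Nat.eqb j i then (d i - c) * (u i * u j) else 0)
        + (-1 * (u i * (B i j - mu) * u j) + (c / INR n - mu) * (u i * u j)))).
    2:{ intros i j _ _; unfold M; destruct (Nat.eqb j i); ring. }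
    rewrite !dsum_plus, !dsum_scal, (dsum_prod n u u), Hu.
    rewrite (dsum_diag n (fun i j => (d i - c) * (u i * u j))).
    assert (g * rsum n (fun i => u i * u i) <= rsum n (fun i => (d i - c) * (u i * u i))).
    { rewrite <- rsum_scal. apply rsum_le; intros i Hi.
      apply Rmult_le_compat_r; [apply Rle_0_sqr|]. specialize (Hd i Hi). unfold d, c; lra. }
    lra. }
  pose proof (psd_pairing_nonneg n M Z Mp Zs Zp) as HP.
  rewrite (dsum_ext n _ (fun i j => (if Nat.eqb j i then (d i - c) * Z i j else 0)
        + (-1 * (B i j * Z i j) + (c / INR n) * Z i j))) in HP.
  2:{ intros i j _ _; unfold M; destruct (Nat.eqb j i); ring. }
  rewrite !dsum_plus, !dsum_scal, (dsum_diag n (fun i j => (d i - c) * Z i j)) in HP.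
  rewrite (rsum_ext n _ (fun i => d i + - c)) in HP by (intros i Hi; rewrite Zd by auto; ring).
  rewrite rsum_plus, rsum_const in HP.
  assert (E1 : inner n A Y = dsum n (fun i j => B i j * Z i j)).
  { apply dsum_ext; intros i j Hi Hj. rewrite HA by auto; unfold Z; ring. }
  assert (E2 : inner n A (fun i j => sigma i * sigma j) = rsum n d).
  { apply dsum_ext; intros i j Hi Hj. rewrite HA by auto.
    replace (_ * _) with ((sigma i * sigma i) * (sigma j * sigma j) * B i j) by ring.
    rewrite !Hsq by auto; ring. }
  rewrite E1, E2 in Hin. change (rsum n (fun i => d i)) with (rsum n d) in HP.
  (* Since [Y] is at least as good, [rsum n d] cancels against the pairing of [B] with [Z] in [HP],
     leaving only the entry sum of [Z]. No entry exceeds 1, so a sum of at least [n^2] forces them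
     all to equal 1. *)
  assert (HZ : INR n * INR n <= dsum n Z).
  { apply Rmult_le_reg_l with (c / INR n); [now apply Rdiv_lt_0_compat|].
    change (dsum n (fun i j => Z i j)) with (dsum n Z) in HP.
    replace (c / INR n * (INR n * INR n)) with (INR n * c) by (field; lra). lra. }
  assert (Zle : forall i j, (i < n)%nat -> (j < n)%nat -> 0 <= 1 + -1 * Z i j).
  { intros i j Hi Hj. pose proof (psd_entry_le n Z i j Zs Zp Hi Hj (Zd i Hi) (Zd j Hj)). lra. }
  assert (H1 : dsum n (fun i j => 1 + -1 * Z i j) <= 0).
  { rewrite dsum_plus, dsum_scal. unfold dsum at 1. rewrite !rsum_const.
    change (dsum n (fun i j => Z i j)) with (dsum n Z). lra. }
  intros i j Hi Hj.
  assert (H2 : 1 + -1 * Z i j <= 0).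
  { eapply Rle_trans; [|exact H1].
    eapply Rle_trans; [apply (rsum_ge_term n (fun j => 1 + -1 * Z i j) j); auto|].
    apply (rsum_ge_term n (fun i => rsum n (fun j => 1 + -1 * Z i j)) i); auto.
    intros; apply rsum_nonneg; auto. }
  specialize (Zle i j Hi Hj).
  assert (HZ1 : Z i j = 1) by lra. unfold Z in HZ1.
  replace (Y i j) with ((sigma i * sigma i) * Y i j * (sigma j * sigma j))
    by (rewrite !Hsq by auto; ring).
  replace (_ * _) with (sigma i * (sigma i * Y i j * sigma j) * sigma j) by ring.
  rewrite HZ1; ring.
Qed.

(** * Heavy pairs and sparse sets *)

Lemma Rabs_sqr x : Rabs x * Rabs x = x * x.
Proof. rewrite <- Rabs_mult. apply Rabs_right, Rle_ge, Rle_0_sqr. Qed.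

(** Cost of deleting the vertex [i] from the set [u]: its row and its column, which share no term
    because [G i i = 0]. *)
Lemma dsum_remove n (G : nat -> nat -> R) u u' i :
  (i < n)%nat -> G i i = 0 -> u i = 1 ->
  (forall j, u' j = if Nat.eqb j i then 0 else u j) ->
  dsum n (fun a b => G a b * (u a * u b)) =
  dsum n (fun a b => G a b * (u' a * u' b))
  + (rsum n (fun b => G i b * u b) + rsum n (fun a => G a i * u a)).
Proof.
  intros Hi HG Hu Hu'.
  rewrite (dsum_ext n _ (fun a b => G a b * (u' a * u' b)
     + ((if Nat.eqb a i then G a b * u b else 0) + (if Nat.eqb b i then G a b * u a else 0)))).
  2:{ intros a b _ _; rewrite !Hu'. destruct (Nat.eqb_spec a i), (Nat.eqb_spec b i); subst;
      rewrite ?Hu, ?HG; ring. }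
  rewrite !dsum_plus. f_equal. f_equal.
  - rewrite dsum_swap. unfold dsum. apply rsum_ext; intros b Hb.
    now rewrite (rsum_delta n i (fun a => G a b * u b)).
  - apply rsum_ext; intros a Ha. now rewrite (rsum_delta n i (fun b => G a b * u a)).
Qed.

(* Every set of at most [M] vertices contains a vertex of small degree;
   peel off such vertices one at a time, with AM-GM weights [t] and [1/t]. *)
Lemma sparse_sum_le n (e : nat -> nat -> R) y t D M :
  0 < t ->
  (forall i j, 0 <= e i j) -> (forall i j, e i j = e j i) -> (forall i, e i i = 0) ->
  (forall u, (forall i, u i = 0 \/ u i = 1) -> 1 <= rsum n u -> rsum n u <= M ->
     dsum n (fun i j => e i j * (u i * u j)) <= D * rsum n u) ->
  forall k u, (forall i, u i = 0 \/ u i = 1) -> rsum n u <= INR k -> rsum n u <= M ->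
  dsum n (fun i j => e i j * Rabs (y i * y j) * (u i * u j)) <=
  t * D * rsum n (fun i => u i * (y i * y i))
  + / t * dsum n (fun i j => e i j * (y j * y j) * (u i * u j)).
Proof.
  intros Ht He Hs Hd H. induction k as [|k IH]; intros u Hu Hk HM.
  - assert (Hu0 : forall i, (i < n)%nat -> u i = 0).
    { intros i Hi. destruct (Hu i) as [|E]; [assumption|exfalso].
      assert (u i <= rsum n u).
      { apply rsum_ge_term; auto. intros j _; destruct (Hu j) as [-> | ->]; lra. }
      simpl in Hk; lra. }
    rewrite (dsum_ext n _ (fun _ _ => 0 * 0)) by (intros; rewrite Hu0 by auto; ring).
    rewrite (dsum_ext n (fun i j => e i j * (y j * y j) * (u i * u j)) (fun _ _ => 0 * 0))
      by (intros; rewrite Hu0 by auto; ring).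
    rewrite (rsum_ext n (fun i => u i * (y i * y i)) (fun _ => 0))
      by (intros; rewrite Hu0 by auto; ring).
    rewrite dsum_scal, rsum_zero; lra.
  - assert (Hun : forall j, 0 <= u j) by (intros j; destruct (Hu j) as [-> | ->]; lra).
    destruct (Rle_dec (rsum n u) (INR k)) as [Hk'|Hk']; [now apply IH|].
    assert (Hne : exists i, (i < n)%nat /\ u i = 1).
    { apply NNPP; intros Hno. apply Hk'.
      rewrite (rsum_ext n u (fun _ => 0)), rsum_zero; [apply pos_INR|].
      intros i Hi. destruct (Hu i); [assumption|]. exfalso; apply Hno; eauto. }
    assert (H1 : 1 <= rsum n u).
    { destruct Hne as (i & Hi & E). rewrite <- E. apply rsum_ge_term; auto. }
    (* Averaging: if every vertex of [u] had degree above [D] inside [u], the total would exceed the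
       bound [H]. *)
    assert (Hlow : exists i, (i < n)%nat /\ u i = 1 /\ rsum n (fun j => e i j * u j) <= D).
    { apply NNPP; intros Hno.
      assert (Hbig : forall i, (i < n)%nat -> u i = 1 -> D < rsum n (fun j => e i j * u j)).
      { intros i Hi E. apply Rnot_le_lt. intros K. apply Hno; eauto. }
      specialize (H u Hu H1 HM).
      rewrite (dsum_ext n _ (fun i j => u i * (e i j * u j))) in H by (intros; ring).
      rewrite (dsum_row n (fun i j => e i j * u j)), <- rsum_scal in H.
      destruct Hne as (i & Hi & E).
      assert (K : u i * rsum n (fun j => e i j * u j) + - (D * u i) <=
             rsum n (fun i => u i * rsum n (fun j => e i j * u j) + (-1) * (D * u i))).
      { eapply Rle_trans;
        [|apply (rsum_ge_term n
            (fun i => u i * rsum n (fun j => e i j * u j) + (-1) * (D * u i)) i); auto].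
        - lra.
        - intros j Hj. destruct (Hu j) as [Ej|Ej]; rewrite Ej; [lra|].
          specialize (Hbig j Hj Ej). lra. }
      rewrite rsum_plus, rsum_scal in K. specialize (Hbig i Hi E). rewrite E in K. lra. }
    destruct Hlow as (i & Hi & E & Hlow).
    set (u' := fun j => if Nat.eqb j i then 0 else u j).
    assert (Hu' : forall j, u' j = 0 \/ u' j = 1).
    { intros j; unfold u'; destruct (Nat.eqb j i); auto. }
    assert (Hr : forall f, rsum n (fun j => u j * f j) = rsum n (fun j => u' j * f j) + f i).
    { intros f. rewrite <- (rsum_delta n i f), <- rsum_plus by auto.
      apply rsum_ext; intros j _; unfold u'. destruct (Nat.eqb_spec j i) as [->|];
        rewrite ?E; ring. }
    assert (Hr1 : rsum n u = rsum n u' + 1).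
    { specialize (Hr (fun _ => 1)).
      rewrite (rsum_ext n u (fun j => u j * 1)), (rsum_ext n u' (fun j => u' j * 1)); auto;
      intros; ring. }
    rewrite S_INR in Hk.
    specialize (IH u' Hu' ltac:(lra) ltac:(lra)).
    rewrite (dsum_remove n (fun a b => e a b * Rabs (y a * y b)) u u' i)
      by (rewrite ?Hd; auto; ring).
    rewrite (dsum_remove n (fun a b => e a b * (y b * y b)) u u' i)
      by (rewrite ?Hd; auto; ring).
    rewrite Hr.
    (* AM-GM at the vertex [i]: the part with weight [t] is summed using the small degree of [i],
       the part with weight [/ t] stays as a sum over edges, to be paid later by the maximal
       degree. *)
    assert (HK : rsum n (fun b => e i b * Rabs (y i * y b) * u b)
                 + rsum n (fun a => e a i * Rabs (y a * y i) * u a) <=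
                 t * (y i * y i) * rsum n (fun j => e i j * u j)
                 + / t * rsum n (fun b => e i b * (y b * y b) * u b)).
    { rewrite <- rsum_plus, <- !rsum_scal, <- rsum_plus. apply rsum_le; intros b Hb.
      rewrite (Hs b i), (Rmult_comm (y b)).
      replace (_ + _) with ((e i b * u b) * (2 * Rabs (y i * y b))) at 1 by ring.
      replace (_ + _) with ((e i b * u b) * (t * (y i * y i) + / t * (y b * y b))) by ring.
      apply Rmult_le_compat_l; [apply Rmult_le_pos; auto|].
      rewrite Rabs_mult.
      rewrite <- (Rabs_sqr (y i)), <- (Rabs_sqr (y b)).
      set (p := Rabs (y i)). set (q := Rabs (y b)).
      enough (0 <= / t * ((t * p - q) * (t * p - q))).
      { replace (/ t * ((t * p - q) * (t * p - q)))
          with (t * (p * p) + / t * (q * q) - 2 * (p * q)) in H0 by (field; lra). lra. }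
      apply Rmult_le_pos; [left; now apply Rinv_0_lt_compat|apply Rle_0_sqr]. }
    assert (0 <= rsum n (fun a => e a i * (y i * y i) * u a)).
    { apply rsum_nonneg; intros.
      apply Rmult_le_pos; auto. apply Rmult_le_pos; auto. apply Rle_0_sqr. }
    assert (t * (y i * y i) * rsum n (fun j => e i j * u j) <= t * (y i * y i) * D).
    { apply Rmult_le_compat_l; auto. apply Rmult_le_pos; [lra|apply Rle_0_sqr]. }
    assert (0 < / t) by now apply Rinv_0_lt_compat.
    assert (0 <= / t * rsum n (fun a => e a i * (y i * y i) * u a)) by (apply Rmult_le_pos; lra).
    rewrite !Rmult_plus_distr_l. lra.
Qed.

(** The factor 2 appears because light pairs are summed once per unordered pair, while the quadratic
    form meets each of them twice. *)
Definition light (tau r : R) : R := if Rle_dec (Rabs r) tau then 2 * r else 0.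

(* A pair with [|y_i y_j| > tau] either lies inside the small set [u = {y^2 >= gam tau}],
   or has one coordinate smaller than [gam] times the other. *)
Lemma heavy_pair a b gam tau :
  0 < gam -> 0 < tau -> tau < Rabs (a * b) ->
  Rabs (a * b) <= gam * (a * a + b * b)
    + Rabs (a * b) * ((if Rle_dec (gam * tau) (a * a) then 1 else 0)
                      * (if Rle_dec (gam * tau) (b * b) then 1 else 0)).
Proof.
  intros Hg Ht H.
  assert (K : forall a b, 0 <= a -> 0 <= b -> tau < a * b -> a * a < gam * tau ->
    a * b <= gam * (b * b)).
  { intros p q Hp Hq H1 H2.
    assert (p < gam * q).
    { apply Rnot_le_lt; intros H3.
      assert (gam * q * p <= p * p) by now apply Rmult_le_compat_r.
      assert (gam * tau < gam * (p * q)) by now apply Rmult_lt_compat_l. lra. }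
    replace (gam * (q * q)) with (gam * q * q) by ring. apply Rmult_le_compat_r; lra. }
  rewrite Rabs_mult in *. rewrite <- (Rabs_sqr a), <- (Rabs_sqr b).
  pose proof (Rabs_pos a) as Ha. pose proof (Rabs_pos b) as Hb.
  set (p := Rabs a) in *. set (q := Rabs b) in *.
  assert (0 <= gam * (p * p)) by (apply Rmult_le_pos; [lra|apply Rle_0_sqr]).
  assert (0 <= gam * (q * q)) by (apply Rmult_le_pos; [lra|apply Rle_0_sqr]).
  rewrite Rmult_plus_distr_l.
  destruct (Rle_dec (gam * tau) (p * p)) as [|E1], (Rle_dec (gam * tau) (q * q)) as [|E2].
  - lra.
  - apply Rnot_le_lt in E2. specialize (K q p Hb Ha ltac:(lra) E2). lra.
  - apply Rnot_le_lt in E1. specialize (K p q Ha Hb H E1). lra.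
  - apply Rnot_le_lt in E1. specialize (K p q Ha Hb H E1). lra.
Qed.

(** Each term pays for one part: [d1] for the light pairs, [2 * gam * Dg] for heavy pairs with
    unbalanced coordinates, [t * D + / t * Dg] for heavy pairs inside the small set, [mu / tau] for
    the mean on heavy pairs. The diagonal contributes a nonpositive amount and is dropped. *)
Lemma quad_le_light_heavy n (B : nat -> nat -> R) y mu tau gam t Dg D M d1 :
  0 <= mu -> 0 < tau -> 0 < gam -> 0 < t -> 0 <= Dg -> 0 <= D ->
  (forall i j, B i j = B j i) -> (forall i, B i i = 0) ->
  (forall i j, B i j = 0 \/ B i j = 1 \/ B i j = -1) ->
  rsum n (fun i => y i * y i) <= 1 ->
  (forall i, (i < n)%nat -> rsum n (fun j => B i j * B i j) <= Dg) ->
  (forall u, (forall i, u i = 0 \/ u i = 1) -> 1 <= rsum n u -> rsum n u <= M ->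
     dsum n (fun i j => B i j * B i j * (u i * u j)) <= D * rsum n u) ->
  1 <= M * (gam * tau) ->
  psum n (fun i j => (B i j - mu) * light tau (y i * y j)) <= d1 ->
  quad n (fun i j => B i j - mu) y <=
  d1 + (2 * gam * Dg + (t * D + / t * Dg)) + mu / tau.
Proof.
  intros Hmu Htau Hgam Ht HDg HD Bs Bd Bv Hy Hdeg Hsp HM Hl.
  set (e := fun i j => B i j * B i j).
  assert (He : forall i j, 0 <= e i j) by (intros; apply Rle_0_sqr).
  assert (Hes : forall i j, e i j = e j i) by (intros; unfold e; now rewrite (Bs i j)).
  assert (Hed : forall i, e i i = 0) by (intros; unfold e; rewrite Bd; ring).
  set (u := fun i => if Rle_dec (gam * tau) (y i * y i) then 1 else 0).
  assert (Hu : forall i, u i = 0 \/ u i = 1)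
    by (intros i; unfold u; destruct (Rle_dec _ _); auto).
  assert (Hgt : 0 < gam * tau) by now apply Rmult_lt_0_compat.
  set (Sy := rsum n (fun i => y i * y i)) in *.
  assert (HSy : 0 <= Sy) by (apply rsum_nonneg; intros; apply Rle_0_sqr).
  (* Each vertex of [u] uses at least [gam * tau] of a total mass at most 1, so [u] has at most
     [/ (gam * tau) <= M] vertices. *)
  assert (HuM : rsum n u <= M).
  { assert (gam * tau * rsum n u <= Sy).
    { rewrite <- rsum_scal. apply rsum_le; intros i _. unfold u.
      destruct (Rle_dec _ _); [lra|]. rewrite Rmult_0_r; apply Rle_0_sqr. }
    apply Rmult_le_reg_l with (gam * tau); lra. }
  assert (Huy : rsum n (fun i => u i * (y i * y i)) <= 1).
  { eapply Rle_trans; [|exact Hy]. apply rsum_le; intros i _.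
    pose proof (Rle_0_sqr (y i)) as K. unfold Rsqr in K.
    destruct (Hu i) as [-> | ->]; lra. }
  assert (Hcol : dsum n (fun i j => e i j * (y j * y j)) <= Dg).
  { rewrite dsum_swap.
    rewrite (dsum_ext n _ (fun i j => (y i * y i) * e i j)) by (intros; rewrite Hes; ring).
    rewrite dsum_row. apply Rle_trans with (Dg * Sy); [|nra].
    unfold Sy; rewrite <- rsum_scal. apply rsum_le; intros i Hi.
    rewrite (Rmult_comm Dg). apply Rmult_le_compat_l; [apply Rle_0_sqr|]. now apply Hdeg. }
  assert (Hrow : dsum n (fun i j => e i j * (y i * y i)) <= Dg).
  { rewrite dsum_swap. rewrite (dsum_ext n _ (fun i j => e i j * (y j * y j))); [exact Hcol|].
    intros; now rewrite Hes. }
  destruct (INR_archimed 1 (rsum n u) ltac:(lra)) as [k Hk].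
  pose proof (sparse_sum_le n e y t D M Ht He Hes Hed Hsp k u Hu ltac:(lra) HuM) as Hs.
  assert (Hcolu : dsum n (fun i j => e i j * (y j * y j) * (u i * u j)) <= Dg).
  { eapply Rle_trans; [|exact Hcol]. apply dsum_le; intros i j _ _.
    assert (0 <= e i j * (y j * y j)) by (apply Rmult_le_pos; auto; apply Rle_0_sqr).
    destruct (Hu i) as [-> | ->], (Hu j) as [-> | ->]; lra. }
  assert (Hit : 0 < / t) by now apply Rinv_0_lt_compat.
  assert (HtD : 0 <= t * D) by (apply Rmult_le_pos; lra).
  assert (T1 : t * D * rsum n (fun i => u i * (y i * y i)) <= t * D * 1)
    by (apply Rmult_le_compat_l; auto).
  assert (T2 : / t * dsum n (fun i j => e i j * (y j * y j) * (u i * u j)) <= / t * Dg)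
    by (apply Rmult_le_compat_l; lra).
  set (h := fun i j => gam * (y i * y i + y j * y j) + Rabs (y i * y j) * (u i * u j)).
  assert (Hh : dsum n (fun i j => e i j * h i j) <= 2 * gam * Dg + (t * D + / t * Dg)).
  { rewrite (dsum_ext n _ (fun i j => (gam * (e i j * (y i * y i)) + gam * (e i j * (y j * y j)))
        + e i j * Rabs (y i * y j) * (u i * u j))) by (intros; unfold h; ring).
    rewrite !dsum_plus, !dsum_scal.
    apply Rmult_le_compat_l with (r := gam) in Hrow; [|lra].
    apply Rmult_le_compat_l with (r := gam) in Hcol; [|lra]. lra. }
  rewrite dsum_psum in Hh.
  rewrite (rsum_ext n (fun i => e i i * h i i) (fun _ => 0)), rsum_zero, Rplus_0_r in Hh
    by (intros; rewrite Hed; ring).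
  assert (Hq : psum n (fun i j => (y i * y i) * (y j * y j) + (y j * y j) * (y i * y i)) <= 1).
  { pose proof (dsum_prod n (fun i => y i * y i) (fun i => y i * y i)) as K.
    rewrite dsum_psum in K. fold Sy in K.
    assert (0 <= rsum n (fun i => y i * y i * (y i * y i)))
      by (apply rsum_nonneg; intros; apply Rle_0_sqr).
    nra. }
  unfold quad. rewrite dsum_psum.
  assert (Hdiag : rsum n (fun i => y i * (B i i - mu) * y i) <= 0).
  { apply Rle_trans with (- mu * Sy); [|nra]. unfold Sy; rewrite <- rsum_scal.
    apply rsum_le; intros i _; rewrite Bd; lra. }
  assert (Hmt : 0 <= mu / tau) by (apply Rmult_le_pos; [lra|left; now apply Rinv_0_lt_compat]).
  apply Rmult_le_compat_l with (r := mu / tau) in Hq; [|lra].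
  rewrite <- psum_scal in Hq.
  match goal with |- ?P + _ <= _ =>
    enough (P <= psum n (fun i j => (B i j - mu) * light tau (y i * y j))
      + psum n (fun i j => e i j * h i j + e j i * h j i)
      + psum n (fun i j => mu / tau *
          ((y i * y i) * (y j * y j) + (y j * y j) * (y i * y i)))) by lra
  end.
  rewrite <- !psum_plus. apply psum_le; intros i j _ _.
  rewrite (Bs j i), (Hes j i).
  replace (h j i) with (h i j)
    by (unfold h; rewrite (Rmult_comm (y j) (y i)), (Rmult_comm (u j) (u i)); ring).
  assert (Hh0 : 0 <= h i j).
  { unfold h. apply Rplus_le_le_0_compat.
    - apply Rmult_le_pos; [lra|]. apply Rplus_le_le_0_compat; apply Rle_0_sqr.
    - apply Rmult_le_pos; [apply Rabs_pos|].
      destruct (Hu i) as [-> | ->], (Hu j) as [-> | ->]; lra. }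
  assert (Hyy : 0 <= mu / tau * (y i * y i * (y j * y j) + y j * y j * (y i * y i))).
  { apply Rmult_le_pos; auto.
    apply Rplus_le_le_0_compat; apply Rmult_le_pos; apply Rle_0_sqr. }
  pose proof (Rmult_le_pos _ _ (He i j) Hh0) as Heh.
  unfold light. destruct (Rle_dec (Rabs (y i * y j)) tau) as [Hle|Hgt'].
  { lra. }
  apply Rnot_le_lt in Hgt'.
  pose proof (heavy_pair (y i) (y j) gam tau Hgam Htau Hgt') as Hp.
  change (Rabs (y i * y j) <= h i j) in Hp.
  assert (HB : B i j * (y i * y j) <= e i j * h i j).
  { apply Rle_trans with (e i j * Rabs (y i * y j)); [|now apply Rmult_le_compat_l].
    pose proof (Rle_abs (y i * y j)). pose proof (Rle_abs (- (y i * y j))).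
    rewrite Rabs_Ropp in *. unfold e.
    destruct (Bv i j) as [-> | [-> | ->]]; lra. }
  (* On a heavy pair [|y_i y_j| <= (y_i y_j)^2 / tau], and the sum of these squares is controlled by
     [Hq]. *)
  assert (Hm : - mu * (y i * y j) <= mu / tau * (y i * y i * (y j * y j))).
  { replace (y i * y i * (y j * y j)) with ((y i * y j) * (y i * y j)) by ring.
    rewrite <- (Rabs_sqr (y i * y j)).
    pose proof (Rle_abs (- (y i * y j))) as K. rewrite Rabs_Ropp in K.
    set (r := Rabs (y i * y j)) in *.
    apply Rle_trans with (mu * r); [apply Rmult_le_compat_l with (r := mu) in K; lra|].
    replace (mu / tau * (r * r)) with (mu * (r * (r / tau))) by (field; lra).
    apply Rmult_le_compat_l; auto.
    rewrite <- (Rmult_1_r r) at 1. apply Rmult_le_compat_l; [lra|].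
    apply Rmult_le_reg_r with tau; auto. replace (r / tau * tau) with r by (field; lra). lra. }
  lra.
Qed.

(** Splitting [x_i x_j - y_i y_j] as [(x_i - y_i) x_j + y_i (x_j - y_j)] leaves products of [h] with
    a coordinate of [x]; AM-GM with weight [kap] turns them into squares plus [h^2 / kap]. The
    squares cost [kap * Rw] through the row sums, and [n h^2 <= kap^2] makes the constant part cost
    another [kap * Rw]. *)
Lemma quad_rounding n (W : nat -> nat -> R) x y kap h Rw :
  0 < kap -> 0 <= Rw ->
  (forall i j, W i j = W j i) ->
  (forall i, (i < n)%nat -> rsum n (fun j => Rabs (W i j)) <= Rw) ->
  rsum n (fun i => x i * x i) <= 1 ->
  (forall i, (i < n)%nat -> Rabs (y i) <= Rabs (x i)) ->
  (forall i, (i < n)%nat -> Rabs (x i - y i) <= h) ->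
  INR n * (h * h) <= kap * kap ->
  quad n W x <= quad n W y + 2 * kap * Rw.
Proof.
  intros Hk HR Ws Hrow Hx Hyx Hxy Hh.
  set (K := dsum n (fun i j => kap / 2 * ((x i * x i) * Rabs (W i j))
       + kap / 2 * ((x j * x j) * Rabs (W j i)) + (h * h / kap) * Rabs (W i j))).
  assert (E1 : quad n W x <= quad n W y + K).
  { unfold quad, K. rewrite <- dsum_plus. apply dsum_le; intros i j Hi Hj.
    rewrite (Ws j i).
    enough (W i j * (x i * x j - y i * y j) <=
            Rabs (W i j) * (kap / 2 * (x i * x i) + kap / 2 * (x j * x j) + h * h / kap)) by lra.
    eapply Rle_trans; [apply Rle_abs|]. rewrite Rabs_mult.
    apply Rmult_le_compat_l; [apply Rabs_pos|].
    replace (x i * x j - y i * y j) with ((x i - y i) * x j + y i * (x j - y j)) by ring.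
    eapply Rle_trans; [apply Rabs_triang|]. rewrite !Rabs_mult.
    rewrite <- (Rabs_sqr (x i)), <- (Rabs_sqr (x j)).
    pose proof (Hxy i Hi) as A1. pose proof (Hxy j Hj) as A2. pose proof (Hyx i Hi) as A3.
    pose proof (Rabs_pos (x i)) as P1. pose proof (Rabs_pos (x j)) as P2.
    pose proof (Rabs_pos (x i - y i)) as P3. pose proof (Rabs_pos (x j - y j)) as P4.
    set (a := Rabs (x i)) in *. set (b := Rabs (x j)) in *.
    assert (Rabs (x i - y i) * b <= h * b) by (apply Rmult_le_compat_r; auto).
    assert (Rabs (y i) * Rabs (x j - y j) <= a * h)
      by (apply Rmult_le_compat; auto; apply Rabs_pos).
    assert (G : forall c, h * c <= kap / 2 * (c * c) + / 2 * (h * h / kap)).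
    { intros c. assert (0 <= / (2 * kap) * ((kap * c - h) * (kap * c - h))).
      { apply Rmult_le_pos; [left; apply Rinv_0_lt_compat; lra|apply Rle_0_sqr]. }
      replace (/ (2 * kap) * ((kap * c - h) * (kap * c - h)))
        with (kap / 2 * (c * c) + / 2 * (h * h / kap) - h * c) in H1 by (field; lra). lra. }
    pose proof (G a). pose proof (G b). lra. }
  assert (E2 : dsum n (fun i j => (x i * x i) * Rabs (W i j)) <= Rw).
  { rewrite dsum_row. apply Rle_trans with (Rw * rsum n (fun i => x i * x i)); [|nra].
    rewrite <- rsum_scal. apply rsum_le; intros i Hi. rewrite (Rmult_comm Rw).
    apply Rmult_le_compat_l; [apply Rle_0_sqr|]. now apply Hrow. }
  assert (E3 : dsum n (fun i j => Rabs (W i j)) <= INR n * Rw).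
  { rewrite <- rsum_const. apply rsum_le; auto. }
  assert (E4 : h * h / kap * (INR n * Rw) <= kap * Rw).
  { replace (h * h / kap * (INR n * Rw)) with (/ kap * Rw * (INR n * (h * h))) by (field; lra).
    replace (kap * Rw) with (/ kap * Rw * (kap * kap)) by (field; lra).
    apply Rmult_le_compat_l; auto. apply Rmult_le_pos; auto. left; now apply Rinv_0_lt_compat. }
  assert (0 <= h * h / kap)
    by (apply Rmult_le_pos; [apply Rle_0_sqr|left; now apply Rinv_0_lt_compat]).
  apply Rmult_le_compat_l with (r := h * h / kap) in E3; auto.
  apply Rmult_le_compat_l with (r := kap / 2) in E2; [|lra].
  unfold K in E1. rewrite !dsum_plus, !dsum_scal in E1.
  rewrite (dsum_swap n (fun i j => x j * x j * Rabs (W j i))) in E1. lra.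
Qed.

Lemma quad_homogeneous n W g :
  (forall x, rsum n (fun i => x i * x i) = 1 -> quad n W x <= g) ->
  forall x, quad n W x <= g * rsum n (fun i => x i * x i).
Proof.
  intros H x. set (s := rsum n (fun i => x i * x i)).
  assert (Hs : 0 <= s) by (apply rsum_nonneg; intros; apply Rle_0_sqr).
  destruct (Req_dec s 0) as [H0|H0].
  - rewrite H0, Rmult_0_r.
    assert (Hx : forall i, (i < n)%nat -> x i = 0).
    { intros i Hi. apply Rsqr_0_uniq. apply Rle_antisym; [|apply Rle_0_sqr].
      rewrite <- H0. apply (rsum_ge_term n (fun i => x i * x i)); auto.
      intros; apply Rle_0_sqr. }
    unfold quad. rewrite (dsum_ext n _ (fun i j => 0 * 0)), dsum_scal; [lra|].
    intros; rewrite Hx by auto; ring.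
  - set (r := / sqrt s).
    assert (Hr : s * (r * r) = 1).
    { unfold r. rewrite <- Rinv_mult, sqrt_sqrt by auto. field; auto. }
    specialize (H (fun i => r * x i)).
    replace (quad n W x) with (s * quad n W (fun i => r * x i)).
    + rewrite (Rmult_comm g). apply Rmult_le_compat_l; auto. apply H.
      rewrite <- Hr, Rmult_comm. unfold s. rewrite <- rsum_scal. apply rsum_ext; intros; ring.
    + unfold quad. rewrite <- dsum_scal. apply dsum_ext; intros.
      replace (s * (r * x i * W i j * (r * x j)))
        with ((s * (r * r)) * (x i * W i j * x j)) by ring.
      rewrite Hr; ring.
Qed.

(** * Finite enumerations *)

(** Entries from [n] on default to 0, so vectors over [[0; 1]] are 0-1 valued at every index, as the
    hypotheses on sets require. *)
Fixpoint vectors (vals : list R) (n : nat) : list (nat -> R) :=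
  match n with
  | O => [fun _ => 0]
  | S m => flat_map (fun f => map (fun v j => if Nat.eqb j m then v else f j) vals)
                    (vectors vals m)
  end.

Lemma vectors_complete vals n g :
  (forall i, (i < n)%nat -> In (g i) vals) ->
  exists f, In f (vectors vals n) /\ forall i, (i < n)%nat -> f i = g i.
Proof.
  induction n as [|n IH]; intros H; simpl.
  - exists (fun _ => 0); split; [auto|intros; lia].
  - destruct IH as (f & Hf & E); [intros; apply H; lia|].
    exists (fun j => if Nat.eqb j n then g n else f j). split.
    + apply in_flat_map. exists f; split; auto.
      apply in_map_iff. exists (g n); split; auto.
    + intros i Hi. destruct (Nat.eqb_spec i n) as [->|]; [reflexivity|apply E; lia].
Qed.

(** Distributivity: a sum over a product set factorizes. This is why the union bounds below are
    first weakened to exponents additive over coordinates. *)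
Lemma lsum_vectors vals n phi :
  lsum (vectors vals n) (fun f => exp (rsum n (fun i => phi (f i)))) =
  (lsum vals (fun v => exp (phi v))) ^ n.
Proof.
  induction n as [|n IH]; simpl.
  - unfold lsum, rsum; simpl. rewrite exp_0; ring.
  - rewrite lsum_flat_map, <- IH, <- lsum_scal. apply lsum_ext; intros f _.
    rewrite lsum_map, Rmult_comm, <- lsum_scal. apply lsum_ext; intros v _.
    rewrite rsum_S, Nat.eqb_refl, exp_plus. f_equal. f_equal.
    apply rsum_ext; intros i Hi. destruct (Nat.eqb_spec i n); [lia|reflexivity].
Qed.

Definition integers (K : nat) : list R :=
  map INR (seq 0 (S K)) ++ map (fun k => - INR k) (seq 0 (S K)).

Lemma round_down K r :
  0 <= r <= INR K -> exists k, (k <= K)%nat /\ INR k <= r <= INR k + 1.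
Proof.
  induction K as [|K IH]; intros Hr.
  - exists 0%nat. simpl in *; split; [lia|lra].
  - destruct (Rle_dec r (INR K)) as [H|H].
    + destruct IH as (k & Hk & E); [lra|]. exists k; split; [lia|auto].
    + exists K. rewrite S_INR in Hr. split; [lia|lra].
Qed.

(** Rounding toward zero, rather than to the nearest point, keeps the rounded vector inside the unit
    ball. *)
Lemma round_toward_zero K h x :
  0 < h -> Rabs x <= h * INR K ->
  exists z, In z (integers K) /\ Rabs (h * z) <= Rabs x /\ Rabs (x - h * z) <= h.
Proof.
  intros Hh Hx.
  destruct (round_down K (Rabs x / h)) as (k & Hk & E1 & E2).
  { split; [apply Rmult_le_pos; [apply Rabs_pos|left; now apply Rinv_0_lt_compat]|].
    apply Rmult_le_reg_l with h; auto. replace (h * (Rabs x / h)) with (Rabs x) by (field; lra).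
    exact Hx. }
  apply Rmult_le_compat_l with (r := h) in E1; [|lra].
  apply Rmult_le_compat_l with (r := h) in E2; [|lra].
  replace (h * (Rabs x / h)) with (Rabs x) in * by (field; lra).
  assert (0 <= h * INR k) by (apply Rmult_le_pos; [lra|apply pos_INR]).
  assert (In k (seq 0 (S K))) by (apply in_seq; lia).
  unfold integers. destruct (Rle_dec 0 x) as [H1|H1].
  - exists (INR k). rewrite (Rabs_right x) in * by lra. repeat split.
    + apply in_app_iff; left. now apply in_map.
    + rewrite Rabs_right; lra.
    + rewrite Rabs_right; lra.
  - exists (- INR k). rewrite (Rabs_left x) in * by lra. repeat split.
    + apply in_app_iff; right. apply in_map_iff. eauto.
    + rewrite Rabs_left1; lra.
    + rewrite Rabs_left1; lra.
Qed.

Lemma exp_neg_INR_le k : exp (- INR k) <= (/ 2) ^ k.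
Proof.
  induction k as [|k IH]; [simpl; rewrite Ropp_0, exp_0; lra|].
  rewrite S_INR. replace (- (INR k + 1)) with (- (1) + - INR k) by ring. rewrite exp_plus.
  simpl. apply Rmult_le_compat; try (left; apply exp_pos); auto.
  rewrite exp_Ropp. apply Rinv_le_contravar; [lra|].
  pose proof (exp_ineq1_le 1); lra.
Qed.

Lemma lsum_integers_le K : lsum (integers K) (fun v => exp (- (v * v))) <= 4.
Proof.
  assert (H : lsum (seq 0 (S K)) (fun k => exp (- (INR k * INR k))) <= 2).
  { change (rsum (S K) (fun k => exp (- (INR k * INR k))) <= 2).
    (* Comparison with the geometric series via [exp (- k^2) <= exp (- k) <= 2^(-k)]; the
       intermediate value is its partial sum, which makes the bound uniform in [K]. *)
    apply Rle_trans with (2 - 2 * (/ 2) ^ (S K)).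
    - induction K as [|K IH].
      + unfold rsum; simpl. rewrite Rmult_0_l, Ropp_0, exp_0; lra.
      + rewrite rsum_S.
        assert (exp (- (INR (S K) * INR (S K))) <= (/ 2) ^ (S K)).
        { eapply Rle_trans; [|apply exp_neg_INR_le].
          assert (- (INR (S K) * INR (S K)) <= - INR (S K))
            by (rewrite S_INR; pose proof (pos_INR K); nra).
          destruct H as [H|H]; [left; now apply exp_increasing|rewrite H; lra]. }
        change ((/ 2) ^ S (S K)) with (/ 2 * (/ 2) ^ (S K)). lra.
    - assert (0 < (/ 2) ^ (S K)) by (apply pow_lt; lra). lra. }
  unfold integers. rewrite lsum_app, !lsum_map.
  rewrite (lsum_ext _ (fun x => exp (- (- INR x * - INR x))) (fun k => exp (- (INR k * INR k)))).
  - lra.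
  - intros; f_equal; ring.
Qed.

(** * Exponential moments *)

Lemma exp_le_compat x y : x <= y -> exp x <= exp y.
Proof. intros [H| ->]; [left; now apply exp_increasing|right; reflexivity]. Qed.

Definition lab (v : option bool) : R :=
  match v with None => 0 | Some true => 1 | Some false => -1 end.

(** The observation conjugated by the labeling. Since [sigma] no longer occurs, all moment estimates
    are uniform in the labeling. *)
Definition signed (w : cfg) (i j : nat) : R :=
  if Nat.ltb i j then lab (w i j) else if Nat.ltb j i then lab (w j i) else 0.

Lemma adj_signed sigma w i j : adj sigma w i j = sigma i * sigma j * signed w i j.
Proof.
  unfold adj, signed. destruct (Nat.ltb i j); [|destruct (Nat.ltb j i)];
    [destruct (w i j) as [[]|]|destruct (w j i) as [[]|]|]; simpl; ring.
Qed.

Lemma signed_sym w i j : signed w i j = signed w j i.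
Proof.
  unfold signed. destruct (Nat.ltb_spec i j), (Nat.ltb_spec j i); try reflexivity; lia.
Qed.

Lemma signed_diag w i : signed w i i = 0.
Proof. unfold signed. now rewrite Nat.ltb_irrefl. Qed.

Lemma signed_lt w i j : (i < j)%nat -> signed w i j = lab (w i j).
Proof. intros H. unfold signed. destruct (Nat.ltb_spec i j); [reflexivity|lia]. Qed.

Lemma signed_values w i j : signed w i j = 0 \/ signed w i j = 1 \/ signed w i j = -1.
Proof.
  unfold signed, lab. destruct (Nat.ltb i j); [|destruct (Nat.ltb j i)];
    [destruct (w i j) as [[]|]|destruct (w j i) as [[]|]|]; auto.
Qed.

Lemma dsum_signed n w (F : R -> R) c :
  F 0 = 0 ->
  dsum n (fun i j => F (signed w i j) * c i j) =
  psum n (fun i j => F (lab (w i j)) * (c i j + c j i)).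
Proof.
  intros HF. rewrite dsum_psum.
  rewrite (rsum_ext n _ (fun _ => 0)), rsum_zero, Rplus_0_r
    by (intros; rewrite signed_diag, HF; ring).
  apply psum_ext; intros i j Hij _. rewrite (signed_sym w j i), signed_lt by auto. ring.
Qed.

(** For [a < b], [at_ i a + at_ i b] indicates that the pair is incident to [i]; this turns a row
    sum into a sum over independent pairs. *)
Definition at_ (i a : nat) : R := if Nat.eqb a i then 1 else 0.

Lemma at_pair_values i a b :
  (a < b)%nat -> at_ i a + at_ i b = 0 \/ at_ i a + at_ i b = 1.
Proof.
  intros H. unfold at_. destruct (Nat.eqb_spec a i), (Nat.eqb_spec b i); try lia; lra.
Qed.

Lemma rsum_signed n w (F : R -> R) i :
  (i < n)%nat -> F 0 = 0 ->
  rsum n (fun j => F (signed w i j)) =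
  psum n (fun a b => F (lab (w a b)) * (at_ i a + at_ i b)).
Proof.
  intros Hi HF. rewrite <- (dsum_signed n w F (fun a b => at_ i a)) by auto.
  rewrite dsum_swap. unfold dsum. apply rsum_ext; intros j Hj.
  rewrite (rsum_ext n _ (fun a => if Nat.eqb a i then F (signed w a j) else 0)).
  - now rewrite (rsum_delta n i (fun a => F (signed w a j))).
  - intros a _. unfold at_. destruct (Nat.eqb a i); ring.
Qed.

Lemma psum_at n i : (i < n)%nat -> psum n (fun a b => at_ i a + at_ i b) = INR n - 1.
Proof.
  intros Hi. pose proof (dsum_psum n (fun a _ => at_ i a)) as H.
  unfold dsum in H. rewrite (rsum_ext n _ (fun a => INR n * at_ i a)) in H
    by (intros; apply rsum_const).
  rewrite rsum_scal in H. unfold at_ in *. rewrite (rsum_delta n i (fun _ => 1)) in H by auto. lra.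
Qed.

Section Moments.
Context (p eps : R) (n : nat) (hp : 0 <= p <= 1) (he : 0 <= eps <= 1).
Let E (f : cfg -> R) : R := expect p eps (pairs n) f cfg0.

Lemma expect_exp_psum_le (g : nat -> nat -> option bool -> R) k :
  (forall i j, g i j None = 0) ->
  E (fun w => exp (psum n (fun i j => g i j (w i j)) + k)) <=
  exp (psum n (fun i j => p * ((1 - eps) * (exp (g i j (Some true)) - 1)
                               + eps * (exp (g i j (Some false)) - 1))) + k).
Proof.
  intros Hg. unfold E.
  rewrite (expect_ext p eps hp he _ _ (fun w => exp k * exp (psum n (fun i j => g i j (w i j)))))
    by (intros; rewrite exp_plus; ring).
  rewrite expect_scal, exp_plus, Rmult_comm. apply Rmult_le_compat_r; [left; apply exp_pos|].
  apply (expect_exp_le p eps hp he (pairs n) (fun q => g (fst q) (snd q)));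
    [apply NoDup_pairs|intros; apply Hg].
Qed.

Lemma exp_01 c r : c = 0 \/ c = 1 -> exp (r * c) - 1 = (exp r - 1) * c.
Proof. intros [-> | ->]; [rewrite Rmult_0_r, exp_0; ring|rewrite Rmult_1_r; ring]. Qed.

(** The tilt [lam] stays free here because its optimal value produces the threshold on [a]. *)
Lemma expect_low_degree i lam x :
  (i < n)%nat ->
  E (fun w => exp (lam * (x - rsum n (signed w i)))) <=
  exp (lam * x - p * (INR n - 1) * (1 - (1 - eps) * exp (- lam) - eps * exp lam)).
Proof.
  intros Hi.
  eapply Rle_trans.
  - unfold E. erewrite (expect_ext p eps hp he).
    + apply (expect_exp_psum_le (fun a b v => - lam * lab v * (at_ i a + at_ i b)) (lam * x)).
      intros; simpl; ring.
    + intros w _. simpl. f_equal.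
      assert (K : rsum n (signed w i) = psum n (fun a b => lab (w a b) * (at_ i a + at_ i b)))
        by exact (rsum_signed n w (fun r => r) i Hi eq_refl).
      rewrite K.
      rewrite (psum_ext n (fun a b => - lam * _ * _)
         (fun a b => - lam * (lab (w a b) * (at_ i a + at_ i b)))) by (intros; ring).
      rewrite psum_scal; ring.
  - right; f_equal.
    rewrite (psum_ext n _ (fun a b => p * ((1 - eps) * exp (- lam) + eps * exp lam - 1)
                                      * (at_ i a + at_ i b))).
    + rewrite psum_scal, psum_at by auto. ring.
    + intros a b Hab _. simpl. rewrite !(exp_01 (at_ i a + at_ i b)) by now apply at_pair_values.
      replace (- lam * 1) with (- lam) by ring. replace (- lam * -1) with lam by ring. ring.
Qed.

(** The crude tilt 1 suffices: [exp 1 - 1 <= 2], and fewer than [n] pairs contain [i]. *)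
Lemma expect_high_degree i x :
  (i < n)%nat ->
  E (fun w => exp (rsum n (fun j => signed w i j * signed w i j) - x)) <=
  exp (2 * p * INR n - x).
Proof.
  intros Hi.
  eapply Rle_trans.
  - unfold E. erewrite (expect_ext p eps hp he).
    + apply (expect_exp_psum_le (fun a b v => lab v * lab v * (at_ i a + at_ i b)) (- x)).
      intros; simpl; ring.
    + intros w _. simpl. f_equal. rewrite (rsum_signed n w (fun r => r * r)) by (auto; ring).
      lra.
  - rewrite (psum_ext n _ (fun a b => p * (exp 1 - 1) * (at_ i a + at_ i b))).
    + rewrite psum_scal, psum_at by auto. apply exp_le_compat.
      pose proof exp_le_3. pose proof (exp_ineq1_le 1).
      assert (1 <= INR n) by (change 1 with (INR 1); apply le_INR; lia).
      assert (p * (exp 1 - 1) * (INR n - 1) <= p * 2 * INR n).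
      { apply Rmult_le_compat; try lra; [apply Rmult_le_pos; lra|].
        apply Rmult_le_compat_l; lra. }
      lra.
    + intros a b Hab _. simpl. rewrite !(exp_01 (at_ i a + at_ i b)) by now apply at_pair_values.
      replace (1 * 1) with 1 by ring. replace (-1 * -1) with 1 by ring. ring.
Qed.

(** An edge inside [u] counts twice in the double sum, hence [exp (2 * lam)]; the number of pairs
    inside [u] is bounded by [|u|^2]. *)
Lemma expect_dense_set u lam x :
  (forall i, u i = 0 \/ u i = 1) -> 0 <= lam ->
  E (fun w => exp (lam * (dsum n (fun i j => signed w i j * signed w i j * (u i * u j)) - x))) <=
  exp (p * exp (2 * lam) * (rsum n u * rsum n u) - lam * x).
Proof.
  intros Hu Hlam.
  eapply Rle_trans.
  - unfold E. erewrite (expect_ext p eps hp he).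
    + apply (expect_exp_psum_le
        (fun a b v => 2 * lam * (lab v * lab v) * (u a * u b)) (- (lam * x))).
      intros; simpl; ring.
    + intros w _. simpl. f_equal.
      rewrite (dsum_signed n w (fun r => r * r) (fun i j => u i * u j)) by ring.
      rewrite (psum_ext n (fun a b => 2 * lam * _ * _)
         (fun a b => lam * (lab (w a b) * lab (w a b) * (u a * u b + u b * u a))))
        by (intros; ring).
      rewrite psum_scal; ring.
  - apply exp_le_compat. apply (Rplus_le_compat_r (- (lam * x))).
    assert (Huu : forall a b, u a * u b = 0 \/ u a * u b = 1).
    { intros a b. destruct (Hu a) as [-> | ->], (Hu b) as [-> | ->]; lra. }
    apply Rle_trans with (psum n (fun a b => p * exp (2 * lam) * (u a * u b))).
    + apply psum_le; intros a b _ _. simpl.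
      replace (2 * lam * (1 * 1)) with (2 * lam) by ring.
      replace (2 * lam * (-1 * -1)) with (2 * lam) by ring.
      rewrite (exp_01 (u a * u b)) by auto.
      assert (0 <= p * (u a * u b)) by (apply Rmult_le_pos; [lra|destruct (Huu a b); lra]).
      lra.
    + rewrite psum_scal. apply Rmult_le_compat_l.
      { apply Rmult_le_pos; [lra|left; apply exp_pos]. }
      pose proof (dsum_prod n u u) as H. rewrite dsum_psum in H.
      rewrite <- H, psum_plus.
      assert (0 <= psum n (fun i j => u j * u i)).
      { apply lsum_nonneg; intros [a b] _; simpl. destruct (Huu b a); lra. }
      assert (0 <= rsum n (fun i => u i * u i))
        by (apply rsum_nonneg; intros; apply Rle_0_sqr).
      lra.
Qed.

(** From [exp x <= 1 / (1 - x)] and [(1 + x + 2 x^2) (1 - x) = 1 + x^2 (1 - 2 x) >= 1]. *)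
Lemma exp_le_quadratic x : - / 2 <= x <= / 2 -> exp x <= 1 + x + 2 * (x * x).
Proof.
  intros Hx. pose proof (exp_ineq1_le (- x)) as H. pose proof (exp_pos x) as Hp.
  assert (K : exp x * exp (- x) = 1) by (rewrite <- exp_plus, Rplus_opp_r; apply exp_0).
  assert (exp x * (1 - x) <= 1) by (rewrite <- K; apply Rmult_le_compat_l; lra).
  apply Rmult_le_reg_r with (1 - x); [lra|].
  assert (0 <= x * x * (1 - 2 * x)) by (apply Rmult_le_pos; [apply Rle_0_sqr|lra]).
  lra.
Qed.

(** Bernstein: [light] is at most [2 * tau] in absolute value, so [4 * (s * tau) <= 1] keeps every
    exponent within [1/2], where the quadratic bound holds. The linear terms cancel the subtracted
    mean, and the squares of [light] sum to at most 2. *)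
Lemma expect_light y tau s x :
  rsum n (fun i => y i * y i) <= 1 -> 0 <= s -> 4 * (s * tau) <= 1 ->
  E (fun w => exp (s * (psum n (fun i j => (signed w i j - p * (1 - 2 * eps))
                                           * light tau (y i * y j)) - x))) <=
  exp (4 * p * (s * s) - s * x).
Proof.
  intros Hy Hs Hst.
  set (t := fun i j => light tau (y i * y j)).
  set (m := psum n (fun i j => p * (1 - 2 * eps) * t i j)).
  eapply Rle_trans.
  - unfold E. erewrite (expect_ext p eps hp he).
    + apply (expect_exp_psum_le (fun a b v => lab v * (s * t a b)) (- s * (m + x))).
      intros; simpl; ring.
    + intros w _. simpl. f_equal.
      rewrite (psum_ext n _ (fun i j => lab (w i j) * t i j + -1 * (p * (1 - 2 * eps) * t i j))).
      2:{ intros i j Hij _. rewrite signed_lt by auto. fold (t i j). ring. }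
      rewrite psum_plus, psum_scal. fold m.
      rewrite (psum_ext n (fun a b => lab (w a b) * (s * t a b))
                (fun a b => s * (lab (w a b) * t a b))) by (intros; ring).
      rewrite psum_scal; ring.
  - apply exp_le_compat.
    assert (Ht2 : psum n (fun i j => t i j * t i j) <= 2).
    { apply Rle_trans with (psum n (fun i j =>
        2 * ((y i * y i) * (y j * y j) + (y j * y j) * (y i * y i)))).
      - apply psum_le; intros i j _ _. unfold t, light.
        pose proof (Rle_0_sqr (y i * y j)) as K. unfold Rsqr in K.
        destruct (Rle_dec _ _); lra.
      - rewrite psum_scal.
        pose proof (dsum_prod n (fun i => y i * y i) (fun i => y i * y i)) as K.
        rewrite dsum_psum in K.
        assert (0 <= rsum n (fun i => y i * y i)) by (apply rsum_nonneg; intros; apply Rle_0_sqr).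
        assert (0 <= rsum n (fun i => y i * y i * (y i * y i)))
          by (apply rsum_nonneg; intros; apply Rle_0_sqr).
        nra. }
    assert (Hm : psum n (fun i j => p * ((1 - eps) * (exp (lab (Some true) * (s * t i j)) - 1)
                     + eps * (exp (lab (Some false) * (s * t i j)) - 1)))
              <= s * m + 2 * p * (s * s) * psum n (fun i j => t i j * t i j)).
    { unfold m. rewrite <- !psum_scal, <- psum_plus. apply psum_le; intros i j _ _. simpl.
      set (z := s * t i j).
      assert (Hz : - / 2 <= z <= / 2).
      { assert (- (2 * tau) <= t i j <= 2 * tau \/ t i j = 0) as [K | K].
        { unfold t, light. destruct (Rle_dec _ _) as [H|]; [left|auto].
          pose proof (Rle_abs (y i * y j)). pose proof (Rle_abs (- (y i * y j))).
          rewrite Rabs_Ropp in *. lra. }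
        - unfold z. pose proof (Rmult_le_compat_l s _ _ Hs (proj1 K)).
          pose proof (Rmult_le_compat_l s _ _ Hs (proj2 K)). lra.
        - unfold z; rewrite K; lra. }
      replace (1 * z) with z by ring. replace (-1 * z) with (- z) by ring.
      pose proof (exp_le_quadratic z Hz) as K1.
      pose proof (exp_le_quadratic (- z) ltac:(lra)) as K2.
      replace (s * (p * (1 - 2 * eps) * t i j) + 2 * p * (s * s) * (t i j * t i j))
        with (p * ((1 - eps) * (z + 2 * (z * z)) + eps * (- z + 2 * (- z * - z))))
        by (unfold z; ring).
      apply Rmult_le_compat_l; [lra|].
      apply Rplus_le_compat; apply Rmult_le_compat_l; lra. }
    assert (0 <= 2 * p * (s * s))
      by (apply Rmult_le_pos; [lra|apply Rle_0_sqr]).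
    apply Rmult_le_compat_l with (r := 2 * p * (s * s)) in Ht2; auto.
    lra.
Qed.

End Moments.

(** * Union bound *)

Lemma exp_lt_1_neg x : exp x < 1 -> x < 0.
Proof.
  intros H. apply Rnot_le_lt; intros K. apply exp_le_compat in K. rewrite exp_0 in K; lra.
Qed.

Lemma indic_true (P : Prop) : P -> indic P = 1.
Proof. intros H; unfold indic. now destruct (excluded_middle_informative P). Qed.

Lemma indic_nonneg P : 0 <= indic P.
Proof. unfold indic. destruct (excluded_middle_informative P); lra. Qed.

Lemma indic_mult_le (P : Prop) r s : 0 <= s -> (P -> r <= s) -> indic P * r <= s.
Proof.
  intros Hs H. unfold indic. destruct (excluded_middle_informative P) as [HP|]; [|lra].
  specialize (H HP); lra.
Qed.

Section UnionBound.
Context (p eps : R) (n : nat) (sigma : nat -> R).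
Context (lam x Dg lam3 D M s d1 tau gam t kap h : R) (K : nat).
Let mu := p * (1 - 2 * eps).

Definition low_degree_weight (w : cfg) : R :=
  rsum n (fun i => exp (lam * (x - rsum n (signed w i)))).

Definition high_degree_weight (w : cfg) : R :=
  rsum n (fun i => exp (rsum n (fun j => signed w i j * signed w i j) - Dg)).

(** The upper size limit makes the exponent [p |u|^2] linear in [|u|]; the lower one excludes the
    empty set, whose term alone would equal 1. *)
Definition dense_set_weight (w : cfg) : R :=
  lsum (vectors [0; 1] n) (fun u => indic (1 <= rsum n u <= M) *
    exp (lam3 * (dsum n (fun i j => signed w i j * signed w i j * (u i * u j)) - D * rsum n u))).

(** The indicator keeps the lattice points of the unit ball: there [expect_light] applies, and there
    are only [exp (O (n))] of them. *)
Definition light_weight (w : cfg) : R :=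
  lsum (vectors (integers K) n) (fun z => indic (rsum n (fun i => (h * z i) * (h * z i)) <= 1) *
    exp (s * (psum n (fun i j => (signed w i j - mu) * light tau ((h * z i) * (h * z j))) - d1))).

Context (hn : (0 < n)%nat) (hp : 0 <= p <= 1) (heps : 0 <= eps <= 1 / 2) (hsg : sign_vec n sigma).
Context (hlam : 0 < lam) (hlam3 : 0 < lam3) (hs : 0 < s) (htau : 0 < tau) (hgam : 0 < gam)
  (ht : 0 < t) (hkap : 0 < kap) (hh : 0 < h) (hDg : 0 <= Dg) (hD : 0 <= D).
Context (hM : 1 <= M * (gam * tau)) (hhk : INR n * (h * h) <= kap * kap) (hK : 1 <= h * INR K).
Context (hst : 4 * (s * tau) <= 1).
Context (hgap : d1 + (2 * gam * Dg + (t * D + / t * Dg)) + mu / tau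
                + 2 * kap * (Dg + INR n * mu) < x).

Let goal (w : cfg) : Prop :=
  sdp_unique_opt n (adj sigma w) (fun i j => sigma i * sigma j).

Lemma mu_nonneg : 0 <= mu.
Proof. apply Rmult_le_pos; lra. Qed.

Lemma weights_nonneg w :
  0 <= low_degree_weight w /\ 0 <= high_degree_weight w /\
  0 <= dense_set_weight w /\ 0 <= light_weight w.
Proof.
  repeat split; apply lsum_nonneg; intros;
    try (left; apply exp_pos); apply Rmult_le_pos;
    [apply indic_nonneg|left; apply exp_pos|apply indic_nonneg|left; apply exp_pos].
Qed.

(** A sum of nonnegative terms below 1 has every exponential below 1, so all exponents are negative
    and all bounds hold simultaneously. [hgap] then provides the strict gap between the quadratic
    form and the row sums that the certificate requires. *)
Lemma weights_lt_1 w :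
  low_degree_weight w < 1 -> high_degree_weight w < 1 ->
  dense_set_weight w < 1 -> light_weight w < 1 -> goal w.
Proof.
  intros H1 H2 H3 H4. pose proof mu_nonneg as Hmu.
  assert (Hdeg : forall i, (i < n)%nat -> x <= rsum n (signed w i)).
  { intros i Hi.
    assert (K1 : lam * (x - rsum n (signed w i)) < 0).
    { apply exp_lt_1_neg. eapply Rle_lt_trans; [|exact H1].
      apply (rsum_ge_term n (fun i => exp (lam * (x - rsum n (signed w i))))); auto.
      intros; left; apply exp_pos. }
    nra. }
  assert (Hdg : forall i, (i < n)%nat -> rsum n (fun j => signed w i j * signed w i j) <= Dg).
  { intros i Hi.
    enough (rsum n (fun j => signed w i j * signed w i j) - Dg < 0) by lra.
    apply exp_lt_1_neg. eapply Rle_lt_trans; [|exact H2].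
    apply (rsum_ge_term n (fun i => exp (rsum n (fun j => signed w i j * signed w i j) - Dg)));
      auto.
    intros; left; apply exp_pos. }
  assert (Hsp : forall u, (forall i, u i = 0 \/ u i = 1) -> 1 <= rsum n u -> rsum n u <= M ->
     dsum n (fun i j => signed w i j * signed w i j * (u i * u j)) <= D * rsum n u).
  { intros u Hu Hu1 HuM.
    destruct (vectors_complete [0; 1] n u) as (f & Hf & E).
    { intros i _. destruct (Hu i) as [-> | ->]; simpl; auto. }
    rewrite (dsum_ext n _ (fun i j => signed w i j * signed w i j * (f i * f j)))
      by (intros; rewrite !E by auto; ring).
    rewrite (rsum_ext n u f) in * by (intros; now rewrite E).
    match goal with |- ?a <= ?b => enough (K1 : lam3 * (a - b) < 0) by nra end.
    apply exp_lt_1_neg. eapply Rle_lt_trans; [|exact H3].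
    rewrite <- Rmult_1_l at 1.
    rewrite <- (indic_true (1 <= rsum n f <= M)) by auto.
    apply (lsum_ge_term (vectors [0; 1] n) (fun u => indic (1 <= rsum n u <= M) *
      exp (lam3 * (dsum n (fun i j => signed w i j * signed w i j * (u i * u j)) - D * rsum n u))));
      auto.
    intros; apply Rmult_le_pos; [apply indic_nonneg|left; apply exp_pos]. }
  apply (unique_opt_of_certificate n _ (signed w) sigma mu x
    (d1 + (2 * gam * Dg + (t * D + / t * Dg)) + mu / tau + 2 * kap * (Dg + INR n * mu)));
    auto.
  { intros; apply adj_signed. }
  { intros; apply signed_sym. }
  apply quad_homogeneous. intros v Hv.
  assert (Hv1 : forall i, (i < n)%nat -> Rabs (v i) <= 1).
  { intros i Hi.
    assert (v i * v i <= 1).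
    { rewrite <- Hv. apply (rsum_ge_term n (fun i => v i * v i)); auto. intros; apply Rle_0_sqr. }
    apply Rabs_le. nra. }
  assert (Hz : exists z : nat -> R, forall i, (i < n)%nat ->
     In (z i) (integers K) /\ Rabs (h * z i) <= Rabs (v i) /\ Rabs (v i - h * z i) <= h).
  (* Lattice coordinates are picked by classical choice; beyond [n] the requirement is vacuous and 0
     serves. *)
  { assert (Hc : forall i, exists zi, (i < n)%nat ->
      In zi (integers K) /\ Rabs (h * zi) <= Rabs (v i) /\ Rabs (v i - h * zi) <= h).
    2:{ exists (fun i => proj1_sig (constructive_indefinite_description _ (Hc i))).
        intros i. exact (proj2_sig (constructive_indefinite_description _ (Hc i))). }
    intros i. destruct (lt_dec i n) as [Hi|]; [|exists 0; easy].
    destruct (round_toward_zero K h (v i) hh) as (zi & Hzi).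
    - specialize (Hv1 i Hi); lra.
    - exists zi; auto. }
  destruct Hz as [z0 Hz0].
  destruct (vectors_complete (integers K) n z0) as (z & Hz & E); [intros i Hi; now apply Hz0|].
  set (y := fun i => h * z i).
  assert (Hy : forall i, (i < n)%nat -> Rabs (y i) <= Rabs (v i) /\ Rabs (v i - y i) <= h).
  { intros i Hi. unfold y. rewrite E by auto. now apply Hz0. }
  assert (Hy1 : rsum n (fun i => y i * y i) <= 1).
  { rewrite <- Hv. apply rsum_le; intros i Hi.
    rewrite <- (Rabs_sqr (y i)), <- (Rabs_sqr (v i)).
    apply Rmult_le_compat; try apply Rabs_pos; now apply Hy. }
  eapply Rle_trans.
  { apply (quad_rounding n _ v y kap h (Dg + INR n * mu)); auto; try lra.
    - assert (0 <= INR n) by apply pos_INR. nra.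
    - intros; now rewrite signed_sym.
    - intros i Hi.
      (* Entries are 0, 1 or -1, hence [|B i j - mu| <= B i j ^ 2 + mu]: the maximal degree also
         controls the absolute row sums. *)
      apply Rle_trans with (rsum n (fun j => signed w i j * signed w i j + mu)).
      + apply rsum_le; intros j _. destruct (signed_values w i j) as [-> | [-> | ->]];
          apply Rabs_le; lra.
      + rewrite rsum_plus, rsum_const. specialize (Hdg i Hi). lra.
    - intros; now apply Hy.
    - intros; now apply Hy. }
  apply Rplus_le_compat_r.
  apply (quad_le_light_heavy n (signed w) y mu tau gam t Dg D M d1); auto.
  { apply signed_sym. } { apply signed_diag. } { apply signed_values. }
  match goal with |- ?a <= ?b => enough (K1 : s * (a - b) < 0) by nra end.
  apply exp_lt_1_neg. eapply Rle_lt_trans; [|exact H4].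
  rewrite <- Rmult_1_l at 1.
  rewrite <- (indic_true (rsum n (fun i => (h * z i) * (h * z i)) <= 1)) by auto.
  apply (lsum_ge_term (vectors (integers K) n)
    (fun z => indic (rsum n (fun i => (h * z i) * (h * z i)) <= 1) *
    exp (s * (psum n (fun i j => (signed w i j - mu) * light tau ((h * z i) * (h * z j))) - d1))));
    auto.
  intros; apply Rmult_le_pos; [apply indic_nonneg|left; apply exp_pos].
Qed.

(** Where optimality fails some weight is at least 1, so the indicator of success is at least 1
    minus the sum of the weights. Averaging this inequality is Markov's inequality and the union
    bound in one step. *)
Lemma prob_unique_opt_ge :
  prob n p eps goal >= 1 -
  (INR n * exp (lam * x - p * (INR n - 1) * (1 - (1 - eps) * exp (- lam) - eps * exp lam))
   + INR n * exp (2 * p * INR n - Dg)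
   + lsum (vectors [0; 1] n) (fun u => indic (1 <= rsum n u <= M) *
       exp (p * exp (2 * lam3) * (rsum n u * rsum n u) - lam3 * (D * rsum n u)))
   + lsum (vectors (integers K) n) (fun z => indic (rsum n (fun i => (h * z i) * (h * z i)) <= 1) *
       exp (4 * p * (s * s) - s * d1))).
Proof.
  assert (he : 0 <= eps <= 1) by lra.
  unfold prob. apply Rle_ge.
  apply Rle_trans with (expect p eps (pairs n) (fun w => 1 + -1 *
    (low_degree_weight w + high_degree_weight w + dense_set_weight w + light_weight w)) cfg0).
  2:{ apply expect_le; auto. intros w _. destruct (weights_nonneg w) as (N1 & N2 & N3 & N4).
      unfold indic. destruct (excluded_middle_informative (goal w)) as [|Hno]; [lra|].
      destruct (Rlt_dec (low_degree_weight w) 1); [|lra].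
      destruct (Rlt_dec (high_degree_weight w) 1); [|lra].
      destruct (Rlt_dec (dense_set_weight w) 1); [|lra].
      destruct (Rlt_dec (light_weight w) 1); [|lra].
      exfalso; apply Hno; now apply weights_lt_1. }
  rewrite expect_plus, expect_scal, expect_const, !expect_plus.
  enough (expect p eps (pairs n) low_degree_weight cfg0 <=
            INR n * exp (lam * x - p * (INR n - 1) * (1 - (1 - eps) * exp (- lam) - eps * exp lam))
       /\ expect p eps (pairs n) high_degree_weight cfg0 <= INR n * exp (2 * p * INR n - Dg)
       /\ expect p eps (pairs n) dense_set_weight cfg0 <=
            lsum (vectors [0; 1] n) (fun u => indic (1 <= rsum n u <= M) *
              exp (p * exp (2 * lam3) * (rsum n u * rsum n u) - lam3 * (D * rsum n u)))
       /\ expect p eps (pairs n) light_weight cfg0 <=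
            lsum (vectors (integers K) n)
              (fun z => indic (rsum n (fun i => (h * z i) * (h * z i)) <= 1) *
                 exp (4 * p * (s * s) - s * d1))) by lra.
  repeat split.
  - rewrite <- rsum_const.
    eapply Rle_trans; [right; exact (expect_lsum p eps (seq 0 n) _
      (fun i w => exp (lam * (x - rsum n (signed w i)))) cfg0)|].
    apply lsum_le; intros i Hi. apply in_seq in Hi.
    apply expect_low_degree; auto; lia.
  - rewrite <- rsum_const.
    eapply Rle_trans; [right; exact (expect_lsum p eps (seq 0 n) _
      (fun i w => exp (rsum n (fun j => signed w i j * signed w i j) - Dg)) cfg0)|].
    apply lsum_le; intros i Hi. apply in_seq in Hi.
    apply expect_high_degree; auto; lia.
  - unfold dense_set_weight. rewrite expect_lsum. apply lsum_le; intros u Hu.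
    rewrite expect_scal. apply Rmult_le_compat_l; [apply indic_nonneg|].
    apply expect_dense_set; auto; [|lra].
    intros i. revert u Hu. clear. induction n as [|m IH]; intros u Hu.
    + destruct Hu as [<-|[]]; auto.
    + simpl in Hu. apply in_flat_map in Hu as (f & Hf & [<- |[<- |[]]]);
        destruct (Nat.eqb i m); auto.
  - unfold light_weight. rewrite expect_lsum. apply lsum_le; intros z _.
    rewrite expect_scal. unfold indic. destruct (excluded_middle_informative _) as [Hz|]; [|lra].
    apply Rmult_le_compat_l; [lra|].
    apply (expect_light p eps n hp he (fun i => h * z i)); auto; lra.
Qed.

End UnionBound.

(** * Evaluation of the four sums and choice of constants *)

Lemma pow_1p_le_exp n r : 0 <= r -> (1 + r) ^ n <= exp (INR n * r).
Proof.
  intros Hr. induction n as [|n IH]; [simpl; rewrite Rmult_0_l, exp_0; lra|].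
  rewrite S_INR, Rmult_plus_distr_r, Rmult_1_l, exp_plus. simpl.
  rewrite (Rmult_comm (1 + r)).
  apply Rmult_le_compat; [apply pow_le; lra|lra|auto|apply exp_ineq1_le].
Qed.

(* Since [1 <= |u|], the weight [b (|u| - 1)] is nonnegative; it makes the sum over all
   subsets factorize while keeping a factor [exp (- b)]. *)
Lemma dense_set_sum_le n p lam3 D M b c3 :
  0 <= p -> 0 <= b -> p * exp (2 * lam3) * M <= c3 ->
  lsum (vectors [0; 1] n) (fun u => indic (1 <= rsum n u <= M) *
       exp (p * exp (2 * lam3) * (rsum n u * rsum n u) - lam3 * (D * rsum n u))) <=
  exp (- b + INR n * exp (c3 - lam3 * D + b)).
Proof.
  intros Hp Hb HM. set (q := c3 - lam3 * D + b).
  apply Rle_trans with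
    (lsum (vectors [0; 1] n) (fun u => exp (- b) * exp (rsum n (fun i => q * u i)))).
  - apply lsum_le; intros u _. apply indic_mult_le.
    + apply Rmult_le_pos; left; apply exp_pos.
    + intros [H1 H2]. rewrite <- exp_plus, rsum_scal. apply exp_le_compat.
      set (U := rsum n u) in *. unfold q.
      assert (0 <= p * exp (2 * lam3)) by (apply Rmult_le_pos; [lra|left; apply exp_pos]).
      assert (p * exp (2 * lam3) * U <= c3) by nra.
      replace (p * exp (2 * lam3) * (U * U)) with (p * exp (2 * lam3) * U * U) by ring.
      nra.
  - rewrite lsum_scal, (lsum_vectors [0; 1] n (fun v => q * v)), exp_plus.
    apply Rmult_le_compat_l; [left; apply exp_pos|].
    unfold lsum; simpl. rewrite Rmult_0_r, Rmult_1_r, exp_0, Rplus_0_r.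
    apply pow_1p_le_exp. left; apply exp_pos.
Qed.

(** In the unit ball the sum of the [z_i^2] is at most [/ (h * h)], so a Gaussian weight can be
    inserted at the cost [exp (/ (h * h))]. The sum then factorizes into [n] one-dimensional sums,
    each at most [4 <= exp 2], whatever [K] is. *)
Lemma lattice_sum_le n K h r :
  0 < h ->
  lsum (vectors (integers K) n)
    (fun z => indic (rsum n (fun i => (h * z i) * (h * z i)) <= 1) * exp r) <=
  exp (/ (h * h) + 2 * INR n + r).
Proof.
  intros Hh.
  apply Rle_trans with (lsum (vectors (integers K) n)
    (fun z => exp (/ (h * h) + r) * exp (rsum n (fun i => - (z i * z i))))).
  - apply lsum_le; intros z _. apply indic_mult_le.
    + apply Rmult_le_pos; left; apply exp_pos.
    + intros H. rewrite <- exp_plus. apply exp_le_compat.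
      rewrite (rsum_ext n _ (fun i => - / (h * h) * ((h * z i) * (h * z i))))
        by (intros; field; lra).
      rewrite rsum_scal. assert (0 < / (h * h)) by (apply Rinv_0_lt_compat; nra). nra.
  - rewrite lsum_scal, (lsum_vectors (integers K) n (fun v => - (v * v))).
    replace (/ (h * h) + 2 * INR n + r) with (/ (h * h) + r + INR n * 2) by ring.
    rewrite (exp_plus (_ + r)). apply Rmult_le_compat_l; [left; apply exp_pos|].
    apply Rle_trans with ((1 + 3) ^ n).
    + apply pow_incr. split.
      * apply lsum_nonneg; intros; left; apply exp_pos.
      * pose proof (lsum_integers_le K); lra.
    + clear. induction n as [|n IH]; [simpl; rewrite Rmult_0_l, exp_0; lra|].
      rewrite S_INR, Rmult_plus_distr_r, Rmult_1_l, exp_plus. simpl.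
      rewrite (Rmult_comm (1 + 3)).
      apply Rmult_le_compat; [apply pow_le; lra|lra|auto|].
      replace 2 with (1 + 1) by ring. rewrite exp_plus. pose proof (exp_ineq1_le 1). nra.
Qed.

(* The optimal tilt is [exp lam = sqrt ((1 - eps) / eps)]. *)
Lemma exists_tilt a eps :
  0 < a -> 0 <= eps <= 1 / 2 -> a * (sqrt (1 - eps) - sqrt eps) ^ 2 > 1 ->
  exists lam, 0 < lam /\ 1 < a * (1 - (1 - eps) * exp (- lam) - eps * exp lam).
Proof.
  intros Ha He H.
  destruct (Req_dec eps 0) as [->|H0].
  - rewrite Rminus_0_r, sqrt_1, sqrt_0 in H.
    assert (Ha1 : 1 < a) by lra.
    (* For [eps = 0] the optimal tilt is infinite; this finite one already yields
       [(a + 1) / 2 > 1]. *)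
    exists (- ln ((a - 1) / (2 * a))).
    assert (Hr : 0 < (a - 1) / (2 * a)) by (apply Rdiv_lt_0_compat; lra).
    split.
    + enough (ln ((a - 1) / (2 * a)) < ln 1) by (rewrite ln_1 in *; lra).
      apply ln_increasing; auto. apply Rmult_lt_reg_r with (2 * a); [lra|].
      replace ((a - 1) / (2 * a) * (2 * a)) with (a - 1) by (field; lra). lra.
    + rewrite Ropp_involutive, exp_ln by auto.
      replace (a * _) with (a - (a - 1) / 2) by (field; lra). lra.
  - set (u := sqrt (1 - eps)) in *. set (v := sqrt eps) in *.
    assert (Hu : u * u = 1 - eps) by (apply sqrt_sqrt; lra).
    assert (Hv : v * v = eps) by (apply sqrt_sqrt; lra).
    assert (Hv0 : 0 < v) by (apply sqrt_lt_R0; lra).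
    assert (Hu0 : 0 < u) by (apply sqrt_lt_R0; lra).
    assert (Huv : v < u).
    { destruct (Req_dec u v) as [E|]; [rewrite E in H; simpl in H; lra|].
      assert (v <= u) by (apply sqrt_le_1_alt; lra). lra. }
    exists (ln (u / v)).
    assert (Hr : 0 < u / v) by (now apply Rdiv_lt_0_compat).
    split.
    + rewrite <- ln_1. apply ln_increasing; [lra|].
      apply Rmult_lt_reg_r with v; auto. replace (u / v * v) with u by (field; lra). lra.
    + rewrite exp_Ropp, exp_ln by auto. clearbody u v.
      enough (E : 1 - (1 - eps) * / (u / v) - eps * (u / v) = (u - v) ^ 2) by (rewrite E; lra).
      replace 1 with (u * u + v * v) at 1 by lra. rewrite <- Hu, <- Hv. field; lra.
Qed.

Theorem theorem6 (a eps : R) (ha : 0 < a) (heps0 : 0 <= eps) (heps1 : eps <= 1 / 2)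
  (hcond : a * (sqrt (1 - eps) - sqrt eps) ^ 2 > 1) :
  exists c : R, 0 < c /\ exists N : nat, forall n : nat, (N <= n)%nat ->
    forall sigma : nat -> R, sign_vec n sigma ->
      prob n (a * ln (INR n) / INR n) eps
        (fun w => sdp_unique_opt n (adj sigma w) (fun i j => sigma i * sigma j))
      >= 1 - Rpower (INR n) (- c).
Proof.
  destruct (exists_tilt a eps ha (conj heps0 heps1) hcond) as (lam & Hlam & Hbeta).
  set (theta := 1 - (1 - eps) * exp (- lam) - eps * exp lam) in *.
  set (beta := a * theta) in *.
  (* Chosen so that requiring row sums above [8 * d * L] costs only a quarter of the surplus
     [beta - 1] in the Chernoff exponent. *)
  set (d := (beta - 1) / 4 / lam / 8).
  assert (Hd : 0 < d) by (unfold d; repeat apply Rdiv_lt_0_compat; lra).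
  (* With degree bound [C * L] the upper tail is [n * exp (2 a L - C L) = exp (- L)]. *)
  set (C := 2 * a + 2). assert (HC : 0 < C) by (unfold C; lra).
  (* [kap], [gam], [t] and [Del] each make one loss equal to [d * L], or bounded by it: see [E5],
     [E1], [E3] and [E2] below. *)
  set (kap := d / (2 * (C + a))).
  assert (Hkap : 0 < kap) by (apply Rdiv_lt_0_compat; lra).
  set (gam := d / (2 * C)). assert (Hgam : 0 < gam) by (apply Rdiv_lt_0_compat; lra).
  set (t := C / d). assert (Ht : 0 < t) by (now apply Rdiv_lt_0_compat).
  set (Del := d / t). assert (HDel : 0 < Del) by (now apply Rdiv_lt_0_compat).
  (* Makes [lam3 * (Del * L) = 4 * L]: two [L] pay for the weight [b = 2 * L], the other two for the
     factor [n] and a spare [exp (- L)]. *)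
  set (lam3 := 4 / Del). assert (Hlam3 : 0 < lam3) by (apply Rdiv_lt_0_compat; lra).
  (* The gain [s * (d * L)] is then [n (4 + 1 / kap^2)]; it covers [n / kap^2 + 2 n] for the lattice
     and [n] for the variance, leaving [exp (- n)]. *)
  set (s0 := (4 + / (kap * kap)) / d).
  assert (Hik : 0 < / (kap * kap)) by (apply Rinv_0_lt_compat, Rmult_lt_0_compat; lra).
  assert (Hs0 : 0 < s0) by (apply Rdiv_lt_0_compat; lra).
  (* The value of [p * exp (2 * lam3) * M], in which [n] and [L] cancel. *)
  set (c3 := 4 * a * s0 * exp (2 * lam3) / gam).
  (* Each of the four failure terms will be at most [n^(-2c)]; half of the exponent is given up to
     absorb the factor 4. *)
  set (c := Rmin ((beta - 1) / 2) 1 / 2).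
  assert (Hc : 0 < c).
  { unfold c. assert (0 < Rmin ((beta - 1) / 2) 1) by (apply Rmin_pos; lra). lra. }
  assert (Hc1 : 2 * c <= (beta - 1) / 2)
    by (unfold c; pose proof (Rmin_l ((beta - 1) / 2) 1); lra).
  assert (Hc2 : 2 * c <= 1) by (unfold c; pose proof (Rmin_r ((beta - 1) / 2) 1); lra).
  (* Lower bounds on [L]: [k1] absorbs the passage from [n - 1] to [n] in the row sums, [k2] the
     loss [mu / tau], [k3] the variance, and [k4] ensures [n^c >= 4]. In [L0], [4 * a] gives
     [p <= 1] and [exp c3] serves the dense sets. *)
  set (k1 := 4 * beta / (beta - 1)). assert (Hk1 : 0 < k1) by (apply Rdiv_lt_0_compat; lra).
  set (k2 := 4 * a * s0 / d). assert (Hk2 : 0 < k2).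
  { apply Rdiv_lt_0_compat; auto. apply Rmult_lt_0_compat; lra. }
  set (k3 := 4 * a * (s0 * s0)). assert (Hk3 : 0 < k3).
  { apply Rmult_lt_0_compat; [lra|now apply Rmult_lt_0_compat]. }
  set (k4 := 3 / c). assert (Hk4 : 0 < k4) by (apply Rdiv_lt_0_compat; lra).
  pose proof (exp_pos c3) as Hc3.
  set (L0 := 1 + 4 * a + k1 + k2 + k3 + k4 + exp c3).
  exists c; split; [exact Hc|].
  destruct (INR_archimed 1 (exp L0) ltac:(lra)) as [N HN].
  exists N. intros n HnN sigma Hsg.
  assert (Hn : exp L0 <= INR n) by (apply le_INR in HnN; lra).
  assert (HnR : 0 < INR n) by (pose proof (exp_pos L0); lra).
  assert (Hn0 : (0 < n)%nat) by (apply INR_lt; simpl; lra).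
  set (L := ln (INR n)).
  assert (HexpL : exp L = INR n) by (now apply exp_ln).
  assert (HL : L0 <= L).
  { apply Rnot_lt_le; intros Hlt. apply exp_increasing in Hlt. lra. }
  unfold L0 in HL.
  assert (HLn : 1 + L <= INR n) by (rewrite <- HexpL; apply exp_ineq1_le).
  set (p := a * L / INR n).
  assert (Hpn : p * INR n = a * L) by (unfold p; field; lra).
  assert (Hp : 0 <= p <= 1).
  { split; [apply Rmult_le_pos; [apply Rmult_le_pos; lra|left; now apply Rinv_0_lt_compat]|].
    apply Rmult_le_reg_r with (INR n); auto. rewrite Hpn, Rmult_1_l, <- HexpL.
    replace L with (L / 2 + L / 2) at 2 by field. rewrite exp_plus.
    pose proof (exp_ineq1_le (L / 2)). nra. }
  set (s := INR n * s0 / L). assert (Hs : 0 < s).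
  { apply Rdiv_lt_0_compat; [apply Rmult_lt_0_compat; lra|lra]. }
  set (tau := L / (4 * INR n * s0)). assert (Htau : 0 < tau).
  { apply Rdiv_lt_0_compat; [lra|]. apply Rmult_lt_0_compat; lra. }
  set (M := / (gam * tau)).
  assert (Hgt : 0 < gam * tau) by (now apply Rmult_lt_0_compat).
  set (h := kap / sqrt (INR n)).
  assert (Hsq : 0 < sqrt (INR n)) by (now apply sqrt_lt_R0).
  assert (Hh : 0 < h) by (now apply Rdiv_lt_0_compat).
  assert (Hsqn : sqrt (INR n) * sqrt (INR n) = INR n) by (apply sqrt_sqrt; lra).
  assert (Hhh : INR n * (h * h) = kap * kap)
    by (unfold h; rewrite <- Hsqn at 1; field; lra).
  (* The lattice must reach every coordinate of a unit vector, that is, the interval from -1 to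
     1. *)
  destruct (INR_archimed h 1 Hh) as [K HK].
  assert (Hst : s * tau = / 4) by (unfold s, tau; field; lra).
  assert (Hmu : p * (1 - 2 * eps) <= p)
    by (rewrite <- (Rmult_1_r p) at 2; apply Rmult_le_compat_l; lra).
  eapply Rge_trans.
  { apply (prob_unique_opt_ge p eps n sigma lam (8 * d * L) (C * L) lam3 (Del * L) M s (d * L)
             tau gam t kap h K); auto; try lra.
    - apply Rmult_le_pos; lra.
    - apply Rmult_le_pos; lra.
    - right. unfold M. field; lra.
    - assert (E1 : 2 * gam * (C * L) = d * L) by (unfold gam; field; lra).
      assert (E2 : t * (Del * L) = d * L) by (unfold Del; field; lra).
      assert (E3 : / t * (C * L) = d * L) by (unfold t; field; lra).
      assert (E4 : p * (1 - 2 * eps) / tau <= d * L).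
      { apply Rle_trans with (4 * a * s0).
        - replace (4 * a * s0) with (p / tau) by (unfold p, tau; field; lra).
          apply Rmult_le_compat_r; [left; now apply Rinv_0_lt_compat|exact Hmu].
        - replace (4 * a * s0) with (d * k2) by (unfold k2; field; lra).
          apply Rmult_le_compat_l; lra. }
      assert (E5 : 2 * kap * (C * L + INR n * (p * (1 - 2 * eps))) <= d * L).
      { apply Rle_trans with (2 * kap * ((C + a) * L)).
        - apply Rmult_le_compat_l; [lra|].
          apply Rmult_le_compat_l with (r := INR n) in Hmu; lra.
        - right. unfold kap. field; lra. }
      rewrite E1, E2, E3.
      assert (0 < d * L) by (apply Rmult_lt_0_compat; lra). lra. }
  apply Rle_ge, Rplus_le_compat_l, Ropp_le_contravar.
  fold theta.
  assert (B1 : INR n * exp (lam * (8 * d * L) - p * (INR n - 1) * theta) <= exp (- (2 * c) * L)).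
  { rewrite <- HexpL at 1. rewrite <- exp_plus. apply exp_le_compat.
    replace (lam * (8 * d * L)) with ((beta - 1) / 4 * L) by (unfold d; field; lra).
    replace (p * (INR n - 1) * theta) with (p * INR n * theta - p * theta) by ring.
    rewrite Hpn.
    assert (p * theta <= (beta - 1) / 4 * L).
    { apply Rmult_le_reg_r with (INR n); auto.
      replace (p * theta * INR n) with (p * INR n * theta) by ring. rewrite Hpn.
      replace (a * L * theta) with ((beta - 1) / 4 * L * k1).
      2:{ replace (a * L * theta) with (beta * L) by (unfold beta; ring).
          unfold k1; field; lra. }
      apply Rmult_le_compat_l; [apply Rmult_le_pos; lra|lra]. }
    replace (a * L * theta) with (beta * L) by (unfold beta; ring).
    assert (2 * c * L <= (beta - 1) / 2 * L) by (apply Rmult_le_compat_r; lra). lra. }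
  assert (Hexp1 : exp (- L) <= exp (- (2 * c) * L)) by (apply exp_le_compat; nra).
  assert (B2 : INR n * exp (2 * p * INR n - C * L) <= exp (- L)).
  { rewrite <- HexpL at 1. rewrite <- exp_plus. apply exp_le_compat.
    rewrite Rmult_assoc, Hpn. unfold C. lra. }
  assert (B3 := dense_set_sum_le n p lam3 (Del * L) M (2 * L) c3 ltac:(lra) ltac:(lra)).
  match type of B3 with ?P -> _ => assert (Q : P) end.
  { right. unfold M, c3, p, tau. field. repeat split; lra. }
  specialize (B3 Q). clear Q.
  assert (B3' : exp (- (2 * L) + INR n * exp (c3 - lam3 * (Del * L) + 2 * L)) <= exp (- L)).
  { apply exp_le_compat.
    replace (c3 - lam3 * (Del * L) + 2 * L) with (c3 + (- L + - L)) by (unfold lam3; field; lra).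
    rewrite !exp_plus.
    assert (E : INR n * exp (- L) = 1)
      by (rewrite <- HexpL, <- exp_plus, Rplus_opp_r; apply exp_0).
    replace (INR n * (exp c3 * (exp (- L) * exp (- L))))
      with (exp c3 * exp (- L) * (INR n * exp (- L))) by ring.
    rewrite E. assert (exp (- L) <= 1) by (rewrite <- exp_0; apply exp_le_compat; lra).
    nra. }
  assert (B4 := lattice_sum_le n K h (4 * p * (s * s) - s * (d * L)) Hh).
  assert (B4' : exp (/ (h * h) + 2 * INR n + (4 * p * (s * s) - s * (d * L))) <= exp (- L)).
  { apply exp_le_compat.
    replace (h * h) with (kap * kap / INR n) by (rewrite <- Hhh; field; lra).
    replace (/ (kap * kap / INR n)) with (INR n * / (kap * kap)) by (field; lra).
    replace (s * (d * L)) with (INR n * (4 + / (kap * kap)))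
      by (unfold s, s0; field; repeat split; lra).
    assert (4 * p * (s * s) <= INR n).
    { replace (4 * p * (s * s)) with (INR n * (k3 / L)) by (unfold p, s, k3; field; lra).
      rewrite <- (Rmult_1_r (INR n)) at 2. apply Rmult_le_compat_l; [lra|].
      apply Rmult_le_reg_r with L; [lra|]. replace (k3 / L * L) with k3 by (field; lra). lra. }
    lra. }
  eapply Rle_trans.
  { apply Rplus_le_compat; [apply Rplus_le_compat; [apply Rplus_le_compat|]|].
    - exact B1.
    - exact (Rle_trans _ _ _ B2 Hexp1).
    - exact (Rle_trans _ _ _ B3 (Rle_trans _ _ _ B3' Hexp1)).
    - exact (Rle_trans _ _ _ B4 (Rle_trans _ _ _ B4' Hexp1)). }
  unfold Rpower. fold L.
  replace (- (2 * c) * L) with (- c * L + - (c * L)) by ring. rewrite exp_plus.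
  pose proof (exp_pos (- c * L)) as H1.
  assert (H2 : 4 * exp (- (c * L)) <= 1).
  { assert (4 <= exp (c * L)).
    { pose proof (exp_ineq1_le (c * L)).
      assert (3 <= c * L).
      { replace 3 with (c * k4) by (unfold k4; field; lra). apply Rmult_le_compat_l; lra. }
      lra. }
    rewrite exp_Ropp. apply Rmult_le_reg_r with (exp (c * L)); [apply exp_pos|].
    rewrite Rmult_assoc, Rinv_l by (pose proof (exp_pos (c * L)); lra). lra. }
  nra.
Qed.
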